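(* Let $G_{n,0}=K_{n,1}/n$ be the Good--Turing estimator of the missing mass $M_{n,0}$. (i) If $\vec{\nu}$ is such that $\mathbb{E}K_{n,2}/\mathbb{E}K_{n,1}$ remains bounded and $\mathbb{E}K_{n,1}\to+\infty$ as $n\to\infty$ (in particular, when $\vec{\nu}$ is regularly varying with index $\alpha\in(0,1]$, or when $\alpha=0$ and $\vec{\nu}(1/\cdot)\in\Pi_a$ with $a\to\infty$), then $$\frac{M_{n,0}}{\mathbb{E}M_{n,0}}\to1\quad\text{in probability},$$ and the Good--Turing estimator is multiplicatively consistent in probability: $$\frac{G_{n,0}}{M_{n,0}}\to1\quad\text{in probability}.$$ (ii) If furthermore $\mathbb{E}K_{n,\overline{2}}/\mathbb{E}K_{n,1}$ remains bounded and if, for all $c>0$, $\sum_{n=0}^\infty\exp(-c\,\mathbb{E}K_{n,1})<\infty$ (in particular, when $\vec{\nu}$ is regularly varying with index $\alpha\in(0,1]$), then these two convergences occur almost surely.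
   Context: Let $(p_j)_{j\ge1}$ be a probability mass function on the positive integers, and let $U_1,U_2,\dots$ be i.i.d. with $\mathbb{P}(U_i=j)=p_j$. For sample size $n$, $X_{n,j}=\sum_{i=1}^n \mathbb{I}_{\{U_i=j\}}$, $K_{n,r}=\sum_{j\ge1}\mathbb{I}_{\{X_{n,j}=r\}}$, $K_{n,\overline{r}}=\sum_{j\ge1}\mathbb{I}_{\{X_{n,j}\ge r\}}$, and $M_{n,0}=\sum_{j\ge1}p_j\mathbb{I}_{\{X_{n,j}=0\}}$. Counting function: $\vec{\nu}(x)=|\{j\ge1: p_j\ge x\}|$ for $x>0$. ''$\vec{\nu}$ is regularly varying with index $\alpha$'' means $\vec{\nu}(1/x)\sim x^\alpha\ell(x)$ as $x\to\infty$ with $\ell$ slowly varying at infinity, i.e. $\lim_{\tau\to\infty}\ell(\tau x)/\ell(\tau)=1$ for all $x>0$. A measurable function $\ell:\mathbb{R}^+\to\mathbb{R}^+$ belongs to $\Pi_a$, for a measurable $a:\mathbb{R}^+\to\mathbb{R}^+$, if for all $x>0$, $\lim_{\tau\to\infty}\frac{\ell(\tau x)-\ell(\tau)}{a(\tau)}=\log x$. *)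

(* Defs.v *)
From HB Require Import structures.
From mathcomp Require Import all_boot all_order all_algebra finmap.
From mathcomp Require Import all_classical all_reals all_analysis.
Set Implicit Arguments.
Unset Strict Implicit.
Unset Printing Implicit Defensive.
Import Order.TTheory GRing.Theory Num.Theory.
Import numFieldNormedType.Exports.
Local Open Scope classical_set_scope.
Local Open Scope ring_scope.

(* Symbols are the integers j >= 1: the value p 0 is never used. *)
Definition is_pmf (R : realType) (p : nat -> R) : Prop :=
  (forall j, (1 <= j)%N -> 0 <= p j) /\
  (\sum_(1 <= j <oo) (p j)%:E = 1)%E.

Definition mutually_independent d d' (T : measurableType d)
    (T' : measurableType d') (R : realType) (P : probability T R)
    (U : nat -> {RV P >-> T'}) : Prop :=
  forall (I : {fset nat}) (A : nat -> set T'),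
    (forall i, measurable (A i)) ->
    P (\bigcap_(i in [set` I]) (U i @^-1` A i)) =
    (\prod_(i <- I) P (U i @^-1` A i))%E.

(* The sample is indexed from 0: U i is the (i+1)-st draw. *)
Definition iid_sample d (T : measurableType d) (R : realType)
    (P : probability T R) (p : nat -> R) (U : nat -> {RV P >-> nat}) : Prop :=
  mutually_independent U /\
  forall i j, (1 <= j)%N -> P (U i @^-1` [set j]) = (p j)%:E.

Section occupancy.
Context d (T : measurableType d) (R : realType) (P : probability T R).
Implicit Types (p : nat -> R) (U : nat -> {RV P >-> nat}).

Definition occ U (n j : nat) (w : T) : nat := (\sum_(i < n) (U i w == j))%N.

(* For r >= 1 at most n terms are nonzero, so the series is finite and [fine]
   does not lose anything; the case r = 0 is not meant to be used. *)
Definition occ_count U (n r : nat) (w : T) : R :=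
  fine (\sum_(1 <= j <oo) ((occ U n j w == r)%:R)%:E)%E.

Definition occ_count_ge U (n r : nat) (w : T) : R :=
  fine (\sum_(1 <= j <oo) ((r <= occ U n j w)%N%:R)%:E)%E.

Definition missing_mass p U (n : nat) (w : T) : R :=
  fine (\sum_(1 <= j <oo) (p j * (occ U n j w == 0%N)%:R)%:E)%E.

Definition good_turing U (n : nat) (w : T) : R := occ_count U n 1 w / n%:R.

Definition mean (X : T -> R) : R := fine ('E_P[X])%E.

Definition cvg_in_probability (Y : nat -> T -> R) (l : R) : Prop :=
  forall eps : R, 0 < eps ->
    P [set w | eps < `|Y n w - l|] @[n --> \oo] --> 0%E.

Definition cvg_almost_surely (Y : nat -> T -> R) (l : R) : Prop :=
  {ae P, forall w, Y n w @[n --> \oo] --> l}.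

End occupancy.

Definition remains_bounded (R : realType) (u : nat -> R) : Prop :=
  exists C : R, \forall n \near \oo, `|u n| <= C.

(* For x > 0 and p a pmf the set is finite, so this is its cardinality. *)
Definition counting_fun (R : realType) (p : nat -> R) (x : R) : R :=
  (#|` fset_set [set j : nat | (1 <= j)%N /\ x <= p j] |)%:R.

Definition slowly_varying (R : realType) (l : R -> R) : Prop :=
  forall x : R, 0 < x -> l (tau * x) / l tau @[tau --> +oo] --> (1 : R).

(* The variable of nu tends to 0: nu (1 / x) ~ x ^ alpha * l x at infinity. *)
Definition regularly_varying (R : realType) (nu : R -> R) (alpha : R) : Prop :=
  exists2 l : R -> R, slowly_varying l &
    nu (1 / x) / (x `^ alpha * l x) @[x --> +oo] --> (1 : R).

(* R^+ is ]0, +oo[ as a domain and [0, +oo[ as a codomain, because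
   nu (1 / x) vanishes for small x. *)
Definition de_Haan_class (R : realType) (a l : R -> R) : Prop :=
  [/\ measurable_fun (`]0, +oo[%classic : set R) a /\ measurable_fun (`]0, +oo[%classic : set R) l,
      (forall x, 0 < x -> 0 <= a x),
      (forall x, 0 < x -> 0 <= l x) &
      forall x : R, 0 < x ->
        (l (tau * x) - l tau) / a tau @[tau --> +oo] --> ln x].

(* Main.v *)
Require Import Defs.
From HB Require Import structures.
From mathcomp Require Import all_boot all_order all_algebra finmap.
From mathcomp Require Import all_classical all_reals all_analysis.
From mathcomp Require Import measurable_realfun ring lra zify.
Import Order.TTheory GRing.Theory Num.Theory.
Import numFieldNormedType.Exports.
Local Open Scope classical_set_scope.
Local Open Scope ring_scope.

Set Implicit Arguments.
Unset Strict Implicit.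
Unset Printing Implicit Defensive.

(* Let X_j be the number of balls in cell j.  For functions f_j >= 0 that are
   monotone in the same direction, E prod_j f_j(X_j) does not decrease when the
   balls are replaced, one at a time, by Bernoulli variables that are independent
   across cells.  Hence a sum Z = sum_j c_j 1{X_j in A}, with A an up-set or a
   down-set, has a Laplace transform bounded by that of an independent sum, and
   both its tails are controlled by Chernoff's method.

   - With c_j = p_j and A = {0}, Z is the missing mass.  A bound on EK_2 / EK_1
     makes E M_n vary slowly in n, and the deviations of M_n are exponentially
     small in EK_1.
   - K_1 is the difference of the counts of cells hit at least once and at least
     twice; both concentrate at scale EK_1 when EK_{>=2} = O(EK_1).  In general
     this holds for the cells with p_j <= L / n only, and the remaining cells
     contribute O(1 / L) of EK_1 to the mean.
   - Almost sure convergence is then Borel-Cantelli, and the Good-Turing ratio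
     follows from E G_n = E M_{n-1} ~ E M_n.
   - For the particular cases, let D(t) be the number of cells with
     1/(2t) <= p_j < 1/t.  Either hypothesis on nu makes D(2t) / D(t) converge to a
     limit in [1, 2].  The sum S(t) of (t p_j)^2 over p_j < 1/t satisfies
     S(t) <= D(t) + S(2t) / 4, which gives S(t) <= 4 D(t); the cells with
     p_j >= 1/t are treated in the same way, so that the means are of order D(n). *)

(** * Series of nonnegative terms *)

Section tsum.
Context (R : realType).
Implicit Types (a b : nat -> R) (c : R).

(** [fine] sends a divergent series to 0, so [tsum] is meaningful only together with [pos_summable].
    The index starts at 1 because the symbols do. *)
Definition tsum a : R := fine (\sum_(1 <= j <oo) (a j)%:E)%E.

Definition pos_summable a :=
  (forall j, (1 <= j)%N -> 0 <= a j) /\ (\sum_(1 <= j <oo) (a j)%:E < +oo)%E.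

Lemma eseries_ge0 a : (forall j, (1 <= j)%N -> 0 <= a j) ->
  (0 <= \sum_(1 <= j <oo) (a j)%:E)%E.
Proof. by move=> a0; apply: nneseries_ge0 => j j1 _; rewrite lee_fin a0. Qed.

Lemma tsumE a : pos_summable a ->
  (\sum_(1 <= j <oo) (a j)%:E)%E = (tsum a)%:E.
Proof.
by move=> [a0 afin]; rewrite /tsum fineK// ge0_fin_numE ?eseries_ge0.
Qed.

Lemma tsum_ge0 a : (forall j, (1 <= j)%N -> 0 <= a j) -> 0 <= tsum a.
Proof. by move=> a0; rewrite /tsum fine_ge0// eseries_ge0. Qed.

Lemma eq_eseries1 a b : (forall j, (1 <= j)%N -> a j = b j) ->
  (\sum_(1 <= j <oo) (a j)%:E = \sum_(1 <= j <oo) (b j)%:E)%E.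
Proof.
move=> ab; congr (limn _); apply/funext => n.
by apply: eq_big_nat => j /andP[j1 _]; rewrite ab.
Qed.

Lemma eq_tsum a b : (forall j, (1 <= j)%N -> a j = b j) -> tsum a = tsum b.
Proof. by move=> ab; rewrite /tsum (eq_eseries1 ab). Qed.

Lemma tsum_partial a N : pos_summable a -> \sum_(1 <= j < N) a j <= tsum a.
Proof.
move=> sa; have [a0 afin] := sa.
rewrite -lee_fin -tsumE// -sumEFin.
by apply: nneseries_lim_ge => j j1 _; rewrite lee_fin a0.
Qed.

Lemma tsum_le a c : (forall j, (1 <= j)%N -> 0 <= a j) ->
  (forall N, \sum_(1 <= j < N) a j <= c) -> pos_summable a /\ tsum a <= c.
Proof.
move=> a0 ac.
have le : (\sum_(1 <= j <oo) (a j)%:E <= c%:E)%E.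
  apply: lime_le.
    by apply: is_cvg_nneseries => j j1 _; rewrite lee_fin a0.
  by apply: nearW => n; rewrite sumEFin lee_fin.
have sa : pos_summable a by split=> //; apply: le_lt_trans le (ltry _).
by split=> //; rewrite -lee_fin -tsumE.
Qed.

Lemma tsum_cvg a : pos_summable a ->
  \sum_(1 <= j < N) a j @[N --> \oo] --> tsum a.
Proof.
move=> sa; have [a0 afin] := sa.
have : (\sum_(1 <= j < N) (a j)%:E)%E @[N --> \oo] --> (tsum a)%:E.
  rewrite -tsumE//.
  by apply: is_cvg_nneseries => j j1 _; rewrite lee_fin a0.
move/fine_cvg; apply: cvg_trans; apply: near_eq_cvg; apply: nearW => N /=.
by rewrite sumEFin.
Qed.

Lemma le_tsum a b : (forall j, (1 <= j)%N -> 0 <= a j) ->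
  (forall j, (1 <= j)%N -> a j <= b j) -> pos_summable b ->
  pos_summable a /\ tsum a <= tsum b.
Proof.
move=> a0 ab sb; apply: tsum_le => // N.
apply: le_trans (tsum_partial N sb).
by apply: ler_sum_nat => j /andP[j1 _]; exact: ab.
Qed.

Lemma pos_summableD a b : pos_summable a -> pos_summable b ->
  pos_summable (fun j => a j + b j).
Proof.
move=> sa sb; have [a0 _] := sa; have [b0 _] := sb.
have [] // := @tsum_le (fun j => a j + b j) (tsum a + tsum b).
  by move=> j j1; rewrite addr_ge0 ?a0 ?b0.
by move=> N; rewrite big_split/= lerD// tsum_partial.
Qed.

Lemma tsumD a b : pos_summable a -> pos_summable b ->
  tsum (fun j => a j + b j) = tsum a + tsum b.
Proof.
move=> sa sb; have /tsum_cvg h := pos_summableD sa sb.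
apply: (cvg_unique _ h) => //.
rewrite (_ : (fun N => _) = (fun N => \sum_(1 <= j < N) a j + \sum_(1 <= j < N) b j)).
  by apply: cvgD; exact: tsum_cvg.
by apply/funext => N; rewrite big_split.
Qed.

Lemma pos_summableZ c a : 0 <= c -> pos_summable a ->
  pos_summable (fun j => c * a j).
Proof.
move=> c0 sa; have [a0 _] := sa.
have [] // := @tsum_le (fun j => c * a j) (c * tsum a).
  by move=> j j1; rewrite mulr_ge0 ?a0.
by move=> N; rewrite -big_distrr/= ler_wpM2l// tsum_partial.
Qed.

Lemma tsumZ c a : 0 <= c -> pos_summable a ->
  tsum (fun j => c * a j) = c * tsum a.
Proof.
move=> c0 sa; have /tsum_cvg h := pos_summableZ c0 sa.
apply: (cvg_unique _ h) => //.
rewrite (_ : (fun N => _) = (fun N => c * \sum_(1 <= j < N) a j)).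
  by apply: cvgMr; exact: tsum_cvg.
by apply/funext => N; rewrite big_distrr.
Qed.

End tsum.

(** * Comparison of the cell counts with independent ones *)

Section draw_mean.
Context (R : realType) (q : nat -> R) (N : nat).
Hypothesis q0 : forall v, 0 <= q v.

(** When the weights [q] sum to 1, this is the expectation of [F] over [n] independent draws of law
    [q], revealed one after the other. *)
Fixpoint draw_mean (n : nat) (F : seq nat -> R) : R :=
  if n is n'.+1 then \sum_(v < N.+1) q v * draw_mean n' (fun s => F (val v :: s))
  else F [::].

Lemma draw_mean_ge0 n F : (forall s, 0 <= F s) -> 0 <= draw_mean n F.
Proof.
elim: n F => [|n IH] F F0 /=; first exact: F0.
by apply: sumr_ge0 => v _; rewrite mulr_ge0 ?IH// q0.
Qed.

Lemma eq_draw_mean n F G : (forall s, F s = G s) -> draw_mean n F = draw_mean n G.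
Proof. by move=> FG; congr draw_mean; apply/funext. Qed.

Lemma le_draw_mean n F G : (forall s, F s <= G s) ->
  draw_mean n F <= draw_mean n G.
Proof.
elim: n F G => [|n IH] F G FG /=; first exact: FG.
by apply: ler_sum => v _; rewrite ler_wpM2l ?q0// IH.
Qed.

(** A finite Fubini: the first draw can be averaged with the others fixed, as a ball thrown on top
    of a given configuration. *)
Lemma draw_mean_sum n (F : nat -> seq nat -> R) (c : nat -> R) :
  \sum_(v < N.+1) c v * draw_mean n (F v) =
  draw_mean n (fun s => \sum_(v < N.+1) c v * F v s).
Proof.
elim: n F => [|n IH] F //=.
under eq_bigr do rewrite big_distrr/=.
rewrite exchange_big/=; apply: eq_bigr => w _.
rewrite -(IH (fun v s => F v (val w :: s))) big_distrr/=.
by apply: eq_bigr => v _; rewrite mulrCA.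
Qed.
End draw_mean.

(** * Binomial expectations, and the comparison for one ball *)

Section binomial_mean.
Context (R : realType).
Implicit Types (x : R) (f : nat -> R).

(** E f(X) for X binomial of parameters [n] and [x], one Bernoulli trial at a time. No binomial
    coefficient appears, and a trial acts on [f] as one step of the ball-by-ball replacement
    does. *)
Fixpoint binomial_mean x (n : nat) (f : nat -> R) : R :=
  if n is n'.+1 then binomial_mean x n' (fun k => (1 - x) * f k + x * f k.+1) else f 0%N.

Lemma eq_bmean x n f g : (forall k, f k = g k) -> binomial_mean x n f = binomial_mean x n g.
Proof. by move=> fg; congr binomial_mean; apply/funext. Qed.

Lemma bmean_lin x n a b f g :
  binomial_mean x n (fun k => a * f k + b * g k) =
  a * binomial_mean x n f + b * binomial_mean x n g.
Proof.
elim: n f g => [|n IH] f g //=.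
by rewrite -IH; apply: eq_bmean => k /=; ring.
Qed.

Lemma bmeanS x n f :
  binomial_mean x n.+1 f =
  (1 - x) * binomial_mean x n f + x * binomial_mean x n (fun k => f k.+1).
Proof. by rewrite /= bmean_lin. Qed.

Lemma bmean_cst x n c : binomial_mean x n (fun=> c) = c.
Proof. by elim: n => //= n IH; rewrite -[RHS]IH; apply: eq_bmean => k; ring. Qed.

Lemma le_bmean x n f g : 0 <= x <= 1 -> (forall k, f k <= g k) ->
  binomial_mean x n f <= binomial_mean x n g.
Proof.
move=> /andP[x0 x1]; elim: n f g => [|n IH] f g fg //=.
by apply: IH => k; rewrite lerD// ler_wpM2l ?subr_ge0.
Qed.

Lemma bmean_ge0 x n f : 0 <= x <= 1 -> (forall k, 0 <= f k) -> 0 <= binomial_mean x n f.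
Proof. by move=> x01 f0; rewrite -(bmean_cst x n 0); exact: le_bmean. Qed.

Lemma bmean_eq0 x n : binomial_mean x n (fun k => (k == 0%N)%:R) = (1 - x) ^+ n.
Proof.
elim: n => [|n IH]; first by rewrite expr0.
by rewrite bmeanS IH bmean_cst mulr0 addr0 exprS.
Qed.

Lemma bmean_eq1 x n : binomial_mean x n (fun k => (k == 1%N)%:R) = n%:R * x * (1 - x) ^+ n.-1.
Proof.
elim: n => [|n IH]; first by rewrite /= !mul0r.
rewrite bmeanS IH (@eq_bmean _ _ _ (fun k => (k == 0%N)%:R)) ?bmean_eq0//.
case: n {IH} => [|n]/=; first by rewrite !expr0; ring.
by rewrite exprS [n.+2%:R]mulrS; ring.
Qed.

Lemma bmean_eq2 x n :
  binomial_mean x n (fun k => (k == 2%N)%:R) = 'C(n, 2)%:R * x ^+ 2 * (1 - x) ^+ n.-2.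
Proof.
elim: n => [|n IH]; first by rewrite /= !mul0r.
rewrite bmeanS IH (@eq_bmean _ _ _ (fun k => (k == 1%N)%:R)) ?bmean_eq1//.
case: n {IH} => [|[|n]]; first by rewrite !bin_small// !mul0r !mulr0 addr0.
  by rewrite /= binn bin_small// !expr0 expr2; field.
rewrite [in RHS]binS bin1 natrD/= [(1 - x) ^+ n.+1]exprS.
move: 'C(n.+2, 2)%:R n.+2%:R ((1 - x) ^+ n) => a b c; ring.
Qed.

Lemma bmean_ge1 x n :
  binomial_mean x n (fun k => (1 <= k)%N%:R) = 1 - (1 - x) ^+ n.
Proof.
rewrite -[X in X - _](bmean_cst x n 1) -bmean_eq0.
have := bmean_lin x n 1 (-1) (fun=> 1) (fun k => (k == 0%N)%:R).
rewrite !mul1r mulN1r => <-; apply: eq_bmean => -[|k] /=; ring.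
Qed.

Lemma bmean_ge1_le x n : 0 <= x <= 1 -> binomial_mean x n (fun k => (1 <= k)%N%:R) <= n%:R * x.
Proof.
move=> x01; rewrite bmean_ge1.
elim: n => [|n IH]; first by rewrite expr0 subrr mul0r.
rewrite exprS mulrS.
have : 0 <= (1 - x) ^+ n <= 1 by rewrite exprn_ge0 ?exprn_ile1//; lra.
nra.
Qed.

(** One more trial raises P(X >= 2) by at most x P(X >= 1) <= n x^2, and n^2 + n <= (n + 1)^2. *)
Lemma bmean_ge2_le x n : 0 <= x <= 1 ->
  binomial_mean x n (fun k => (2 <= k)%N%:R) <= (n%:R * x) ^+ 2.
Proof.
move=> x01; elim: n => [|n IH]; first by rewrite /= mul0r expr0n.
rewrite bmeanS; have := bmean_ge1_le n x01.
have : 0 <= binomial_mean x n (fun k => (2 <= k)%N%:R) by apply: bmean_ge0.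
rewrite -(natr1 n); have : 0 <= n%:R :> R by [].
move: IH; move: n%:R (binomial_mean x n (fun k => (2 <= k)%N%:R))
  (binomial_mean x n (fun k => (1 <= k)%N%:R)) => m a b am m0 a0 bm.
have x0 : 0 <= x by case/andP: x01.
have {}bm := ler_wpM2l x0 bm.
have : 0 <= x * a by rewrite mulr_ge0//; case/andP: x01.
have : 0 <= m * (x * x) by rewrite !mulr_ge0//; case/andP: x01.
by have := sqr_ge0 x; rewrite !expr2; lra.
Qed.

(* One ball thrown into disjoint cells is compared with independent Bernoulli
   variables; [g] and [h] are the values without and with the ball in the cell. *)
Lemma one_ball_le N (p g h : nat -> R) :
  (forall v, 0 <= p v) -> \sum_(1 <= v < N.+1) p v <= 1 ->
  (forall v, 0 <= g v) -> (forall v, 0 <= h v) ->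
  (forall v, g v <= h v) \/ (forall v, h v <= g v) ->
  (1 - \sum_(1 <= v < N.+1) p v) * \prod_(1 <= j < N.+1) g j +
  \sum_(1 <= v < N.+1) p v * \prod_(1 <= j < N.+1) (if v == j then h j else g j)
  <= \prod_(1 <= j < N.+1) ((1 - p j) * g j + p j * h j).
Proof.
move=> p0 ps g0 h0 gh.
(* [G M] is the product without the ball, [S M] the mean change made by a ball that may fall into
   the first [M] cells, [Q M] the product for independent trials. *)
pose G M := \prod_(1 <= j < M.+1) g j.
pose S M := \sum_(1 <= v < M.+1)
  p v * (\prod_(1 <= j < M.+1) (if v == j then h j else g j) - G M).
pose Q M := \prod_(1 <= j < M.+1) ((1 - p j) * g j + p j * h j).
have -> : (1 - \sum_(1 <= v < N.+1) p v) * G N + \sum_(1 <= v < N.+1)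
    p v * \prod_(1 <= j < N.+1) (if v == j then h j else g j) = G N + S N.
  rewrite /S; under [in RHS]eq_bigr do rewrite mulrBr.
  by rewrite sumrB -big_distrl/=; ring.
have G0 M : 0 <= G M by apply: prodr_ge0.
have GS M : G M.+1 = G M * g M.+1 by rewrite /G big_nat_recr.
have SS M : S M.+1 = g M.+1 * S M + p M.+1 * (h M.+1 - g M.+1) * G M.
  rewrite /S big_nat_recr//= big_distrr/= GS; congr (_ + _).
    apply: eq_big_nat => v /andP[_ vM]; rewrite big_nat_recr//=.
    by rewrite (ltn_eqF vM); ring.
  rewrite big_nat_recr//= eqxx.
  rewrite (@eq_big_nat _ _ _ _ _ _ g) -/(G M); first by ring.
  by move=> j /andP[_ jM]; rewrite gtn_eqF.
have p1 M : (M < N)%N -> p M.+1 <= 1.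
  move=> MN; apply: le_trans ps.
  rewrite (bigD1_seq M.+1) ?mem_index_iota ?iota_uniq//=.
  by rewrite lerDl sumr_ge0.
(* The induction also carries the sign of [S M]: its terms all go in the common direction of
   [h - g]. So the cross term p (h - g) S, present for independent trials and absent for a single
   ball, is nonnegative. *)
have main M : (M <= N)%N -> G M + S M <= Q M /\
    forall v, 0 <= (h v - g v) * S M.
  elim: M => [|M IH] MN.
    by rewrite /G /S /Q !big_geq// addr0; split=> // v; rewrite mulr0.
  have [IH1 IH2] := IH (ltnW MN).
  rewrite SS GS.
  have -> : Q M.+1 = Q M * ((1 - p M.+1) * g M.+1 + p M.+1 * h M.+1).
    by rewrite /Q big_nat_recr.
  split=> [|v].
    have k0 : 0 <= (1 - p M.+1) * g M.+1 + p M.+1 * h M.+1.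
      by rewrite addr_ge0// mulr_ge0// subr_ge0 p1.
    have := ler_wpM2r k0 IH1; have := mulr_ge0 (p0 M.+1) (IH2 M.+1).
    lra.
  rewrite mulrDr addr_ge0//.
    by rewrite mulrCA mulr_ge0.
  rewrite mulrA mulr_ge0// mulrCA mulr_ge0//.
  by case: gh => gh; [rewrite mulr_ge0 ?subr_ge0|rewrite mulr_le0 ?subr_le0].
exact: (main N _).1.
Qed.

End binomial_mean.

(** * Multinomial counts against independent binomial ones *)

Section multinomial.
Context (R : realType) (p : nat -> R) (N : nat).
Hypothesis p01 : forall v, 0 <= p v <= 1.
Hypothesis psum : \sum_(1 <= v < N.+1) p v <= 1.

(* The cell 0 collects the draws outside [1, N]. *)
Definition cell_prob (v : nat) : R :=
  if v == 0%N then 1 - \sum_(1 <= j < N.+1) p j else p v.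

Lemma cell_prob_ge0 v : 0 <= cell_prob v.
Proof.
rewrite /cell_prob; case: eqP => _; first by rewrite subr_ge0.
by case/andP: (p01 v).
Qed.

Lemma sum_cells (F : nat -> R) : \sum_(v < N.+1) cell_prob v * F v =
  (1 - \sum_(1 <= j < N.+1) p j) * F 0%N + \sum_(1 <= v < N.+1) p v * F v.
Proof.
rewrite -(big_mkord xpredT (fun v => cell_prob v * F v)) big_ltn// /cell_prob eqxx.
by congr (_ + _); apply: eq_big_nat => -[|v].
Qed.

(** Induction on the balls. With the others fixed, [one_ball_le] replaces one ball by independent
    trials, that is, [f] by [f']; as [f'] is again nonnegative and monotone in the same direction,
    the induction hypothesis treats the remaining balls. *)
Lemma draw_prod_le n (f : nat -> nat -> R) : (forall j k, 0 <= f j k) ->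
  (forall j k, f j k <= f j k.+1) \/ (forall j k, f j k.+1 <= f j k) ->
  draw_mean cell_prob N n (fun s => \prod_(1 <= j < N.+1) f j (count_mem j s)) <=
  \prod_(1 <= j < N.+1) binomial_mean (p j) n (f j).
Proof.
elim: n f => [|n IH] f f0 fm /=; first by [].
pose f' j k := (1 - p j) * f j k + p j * f j k.+1.
have p0 v : 0 <= p v by case/andP: (p01 v).
have p1 v : 0 <= 1 - p v by rewrite subr_ge0; case/andP: (p01 v).
have f'0 j k : 0 <= f' j k by rewrite addr_ge0// mulr_ge0.
have f'm : (forall j k, f' j k <= f' j k.+1) \/ (forall j k, f' j k.+1 <= f' j k).
  by case: fm => fm; [left|right] => j k; rewrite lerD// ler_wpM2l.
apply: le_trans (IH f' f'0 f'm).
rewrite (draw_mean_sum cell_prob N n (fun v s => \prod_(1 <= j < N.+1) f j ((v == j) + count_mem j s)%N)).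
apply: le_draw_mean => [v|s]; first exact: cell_prob_ge0.
rewrite (sum_cells (fun v => \prod_(1 <= j < N.+1) f j ((v == j) + count_mem j s)%N)).
apply: le_trans (@one_ball_le R N p (fun j => f j (count_mem j s))
  (fun j => f j (count_mem j s).+1) p0 psum _ _ _) => //; last first.
  by case: fm => fm; [left|right] => j.
apply: lerD.
  (* A ball in the cell 0 changes none of the factors. *)
  rewrite ler_wpM2l ?subr_ge0// le_eqVlt; apply/orP; left; apply/eqP.
  by apply: eq_big_nat => -[|j].
apply: ler_sum_nat => v _; rewrite le_eqVlt; apply/orP; left; apply/eqP; congr (_ * _); apply: eq_bigr => j _.
by case: eqP.
Qed.

Lemma draw_mean1 n (f : nat -> R) j : (1 <= j <= N)%N ->
  draw_mean cell_prob N n (fun s => f (count_mem j s)) = binomial_mean (p j) n f.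
Proof.
move=> jN; elim: n f => [|n IH] f //=.
rewrite (draw_mean_sum cell_prob N n (fun v s => f ((v == j) + count_mem j s)%N)).
rewrite -IH; apply: eq_draw_mean => s.
rewrite (sum_cells (fun v => f ((v == j) + count_mem j s)%N)).
have jI : j \in index_iota 1 N.+1 by rewrite mem_index_iota ltnS.
rewrite (bigD1_seq j)//= ?iota_uniq// [X in _ + X](bigD1_seq j)//= ?iota_uniq// eqxx.
rewrite (_ : (0%N == j) = false); last by case: (j) jN.
rewrite [X in _ + (_ + X) = _](_ : _ =
    (\sum_(1 <= v < N.+1 | v != j) p v) * f (count_mem j s)); last first.
  by rewrite big_distrl/=; apply: eq_bigr => v /negPf ->.
by rewrite !add0n add1n; ring.
Qed.
End multinomial.

(** * Measurability of functions of the sample *)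

Section sample.
Context d (T : measurableType d) (R : realType) (P : probability T R).
Variable U : nat -> {RV P >-> nat}.

(** The start [k] is a parameter because inductions on the length remove the first draw. *)
Definition sample (k n : nat) (w : T) : seq nat := [seq U i w | i <- iota k n].

Lemma measurable_draw i (A : set nat) : measurable (U i @^-1` A).
Proof. by rewrite -[X in measurable X]setTI; apply: measurable_funP. Qed.

(** [G] is arbitrary: the draws are discrete, so a preimage is a countable union over the value of
    the first draw. *)
Lemma measurable_fun_sample d' (T' : measurableType d') (G : seq nat -> T') k n :
  measurable_fun setT (fun w => G (sample k n w)).
Proof.
elim: n k G => [|n IH] k G; first exact: (measurable_cst (G [::])).
move=> _ Y mY; rewrite setTI.
rewrite (_ : _ @^-1` _ = \bigcup_v (U k @^-1` [set v] `&`
    (fun w => G (v :: sample k.+1 n w)) @^-1` Y)).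
  apply: bigcupT_measurable => v; apply: measurableI; first exact: measurable_draw.
  by rewrite -[X in measurable X]setTI; exact: (IH k.+1 (fun s => G (v :: s)) measurableT Y mY).
apply/seteqP; split=> [w Yw|w [v _ [/= Uv Yw]]]; first by exists (U k w).
by rewrite /preimage/= -Uv in Yw *.
Qed.

Lemma occ_sample n j w : occ U n j w = count_mem j (sample 0 n w).
Proof.
rewrite /occ /sample -sum1_count big_map -(big_mkord xpredT (fun i => (U i w == j) : nat)).
by rewrite /index_iota subn0 [RHS]big_mkcond; apply: eq_bigr => i _ /=; case: eqP.
Qed.

(** This settles the measurability of every statistic below, infinite series over the cells
    included. *)
Lemma measurable_occ d' (T' : measurableType d') (G : (nat -> nat) -> T') n :
  measurable_fun setT (fun w => G (fun j => occ U n j w)).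
Proof.
have := @measurable_fun_sample _ T' (fun s => G (fun j => count_mem j s)) 0 n.
apply: eq_measurable_fun => w _; congr G.
by apply/funext => j; rewrite occ_sample.
Qed.

End sample.

(** * Law of the sample and of its cell counts *)

Section law.
Context d (T : measurableType d) (R : realType) (P : probability T R).
Variables (p : nat -> R) (U : nat -> {RV P >-> nat}).
Hypothesis p01 : forall v, 0 <= p v <= 1.
Hypothesis psum : forall N, \sum_(1 <= v < N) p v <= 1.
Hypothesis hU : iid_sample p U.

(** Sending the draws outside [1, N] to the cell 0 gives the finite alphabet of [draw_mean] and
    preserves the counts of the cells 1 to N. *)
Definition clip (N v : nat) : nat := if (v <= N)%N then v else 0%N.

Lemma prob_cell N i v : (v <= N)%N ->
  P (U i @^-1` [set u | clip N u = v]) = (cell_prob p N v)%:E.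
Proof.
move=> vN; have [_ hp] := hU.
have pos u : (1 <= u <= N)%N -> [set x | clip N x = u] = [set u].
  move=> /andP[u1 uN]; apply/seteqP; split=> x /=; rewrite /clip; last by move=> ->; rewrite uN.
  by case: ifP => // _ u0; rewrite -u0 in u1.
rewrite /cell_prob; case: eqP => [->|/eqP]; last first.
  by rewrite -lt0n => v1; rewrite pos ?v1// hp.
(* The cell 0 is reached as the complement of the finite disjoint union of the cells 1 to N. *)
have -> : U i @^-1` [set u | clip N u = 0%N] =
    ~` (\big[setU/set0]_(v < N) (U i @^-1` [set v.+1])).
  rewrite -(bigcup_mkord N (fun v => U i @^-1` [set v.+1])) /clip.
  apply/seteqP; split=> w /=.
    case: ifP => [_ U0 [x /= xN Ux]|/negbT NU _ [x /= xN Ux]].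
      by rewrite U0 in Ux.
    by rewrite Ux xN in NU.
  case: ifP => // UN; case E : (U i w) => [//|u] H; exfalso; apply: H.
  by exists u => //=; rewrite -E.
rewrite probability_setC; last first.
  by apply: bigsetU_measurable => u _; exact: measurable_draw.
rewrite (measure_bigsetU P (F := fun v => U i @^-1` [set v.+1])).
- rewrite big_add1 big_mkord EFinB -sumEFin; congr (_ - _)%E.
  by apply: eq_bigr => u _; rewrite /= hp.
- by move=> u; exact: measurable_draw.
- by apply/trivIsetP => a b _ _ ab; apply/seteqP; split=> // w [/= ->] [/eqP]; rewrite (negPf ab).
Qed.

Definition cylinder (k : nat) (B : nat -> set nat) : set T :=
  \bigcap_(i in [set i | (i < k)%N]) (U i @^-1` B i).

Lemma cylinderS k B A :
  cylinder k B `&` (U k @^-1` A) = cylinder k.+1 (fun i => if i == k then A else B i).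
Proof.
apply/seteqP; split=> [w [Cw Aw] i /=|w Cw].
  by rewrite ltnS leq_eqVlt; case: eqP => [-> _//|_ /= ik]; exact: Cw.
split=> [i /= ik|]; last by have /= := Cw k (ltnSn _); rewrite eqxx.
by have /= := Cw i (ltnW ik); rewrite ltn_eqF.
Qed.

Lemma measurable_cylinder k B : measurable (cylinder k B).
Proof.
apply: fin_bigcap_measurable => [|i _]; first exact: finite_II.
exact: measurable_draw.
Qed.

Lemma prob_cylinder k B : P (cylinder k B) = (\prod_(i < k) P (U i @^-1` B i))%E.
Proof.
have [ind _] := hU.
have := ind [fset i in iota 0 k]%fset B (fun _ => Logic.I).
rewrite (_ : \bigcap_(i in _) _ = cylinder k B); last first.
  rewrite /cylinder (_ : [set` _] = [set i | (i < k)%N])//; apply/seteqP.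
  by split=> i /=; rewrite !inE mem_iota add0n.
move=> ->; rewrite -(big_mkord xpredT (fun i => P (U i @^-1` B i))).
rewrite /index_iota subn0; apply: perm_big; apply: uniq_perm.
- exact: fset_uniq.
- exact: iota_uniq.
- by move=> i; rewrite !inE.
Qed.

Lemma prob_cylinderS k B A :
  P (cylinder k B `&` (U k @^-1` A)) = (P (cylinder k B) * P (U k @^-1` A))%E.
Proof.
rewrite cylinderS !prob_cylinder big_ord_recr/= eqxx; congr (_ * _)%E.
by apply: eq_bigr => i _; rewrite ltn_eqF.
Qed.

(** The cylinder of the first [k] draws is there for the induction on [n]: splitting on the value of
    draw [k] gives cylinders of [k + 1] draws, whose probabilities factor by independence. *)
Lemma integral_cylinder N n k B (F : seq nat -> R) : (forall s, 0 <= F s) ->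
  (\int[P]_(w in cylinder k B) (F (map (clip N) (sample U k n w)))%:E =
  P (cylinder k B) * (draw_mean (cell_prob p N) N n F)%:E)%E.
Proof.
elim: n k B F => [|n IH] k B F F0 /=.
  transitivity (\int[P]_(w in cylinder k B) cst (F [::])%:E w)%E.
    exact: eq_integral.
  rewrite integral_cst; last exact: measurable_cylinder.
  by rewrite [RHS]muleC.
pose C v := cylinder k B `&` (U k @^-1` [set u | clip N u = v]).
have CE : cylinder k B = \big[setU/set0]_(v <- iota 0 N.+1) C v.
  rewrite -bigcup_seq; apply/seteqP; split=> [w Bw|w [v _ []//]].
  exists (clip N (U k w)) => //.
  change (is_true (clip N (U k w) \in iota 0 N.+1)).
  by rewrite mem_iota add0n ltnS /clip; case: ifP.
have mC v : measurable (C v) by rewrite /C cylinderS; exact: measurable_cylinder.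
have IHv v : (v <= N)%N ->
  (\int[P]_(w in C v) (F (map (clip N) (sample U k n.+1 w)))%:E =
   P (cylinder k B) * (cell_prob p N v * draw_mean (cell_prob p N) N n (fun s => F (v :: s)))%:E)%E.
  move=> vN; transitivity (\int[P]_(w in C v) (F (v :: map (clip N) (sample U k.+1 n w)))%:E)%E.
    by apply: eq_integral => w /set_mem[_ /= <-].
  rewrite EFinM muleA -(prob_cell k vN) -prob_cylinderS.
  rewrite /C cylinderS (IH k.+1 _ (fun s => F (v :: s)))//.
rewrite {1}CE ge0_integral_bigsetU//; first last.
- by move=> w _; rewrite lee_fin.
- apply: (measurable_funS measurableT (@subsetT _ _)); apply/measurable_EFinP.
  exact: (@measurable_fun_sample _ _ _ _ U _ _ (fun s => F (map (clip N) s)) k n.+1).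
- apply/trivIsetP => a b _ _ ab; apply/seteqP; split=> // w [[_ /= wa] [_ /= wb]].
  by move: ab; rewrite -wa -wb eqxx.
- exact: iota_uniq.
rewrite -/(iota 0 N.+1) -[iota _ _]/(index_iota 0 N.+1) big_mkord.
rewrite -sumEFin ge0_sume_distrr; last first.
  move=> v _; rewrite lee_fin mulr_ge0 ?cell_prob_ge0//.
  by apply: draw_mean_ge0 => // u; exact: cell_prob_ge0.
by apply: eq_bigr => v _; rewrite IHv// -ltnS.
Qed.

Lemma integral_sample N n (F : seq nat -> R) : (forall s, 0 <= F s) ->
  (\int[P]_w (F (map (clip N) (sample U 0 n w)))%:E =
  (draw_mean (cell_prob p N) N n F)%:E)%E.
Proof.
move=> F0; have C0 : cylinder 0 (fun=> setT) = setT by apply/seteqP; split.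
by rewrite -{1}C0 integral_cylinder// C0 probability_setT mul1e.
Qed.

Lemma count_clip N s j : (1 <= j <= N)%N ->
  count_mem j (map (clip N) s) = count_mem j s.
Proof.
move=> /andP[j1 jN]; rewrite count_map; apply: eq_count => v /=; rewrite /clip.
by case: ifPn => // vN; apply/idP/idP => /eqP; lia.
Qed.

Lemma integral_occ n (f : nat -> R) j : (1 <= j)%N -> (forall k, 0 <= f k) ->
  (\int[P]_w (f (occ U n j w))%:E = (binomial_mean (p j) n f)%:E)%E.
Proof.
move=> j1 f0; rewrite -(@draw_mean1 _ p j)//; last by rewrite j1/=.
rewrite -integral_sample//; apply: eq_integral => w _.
by rewrite occ_sample count_clip// j1/=.
Qed.

Lemma integral_prod_occ_le N n (f : nat -> nat -> R) : (forall j k, 0 <= f j k) ->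
  (forall j k, f j k <= f j k.+1) \/ (forall j k, f j k.+1 <= f j k) ->
  (\int[P]_w (\prod_(1 <= j < N.+1) f j (occ U n j w))%:E <=
   (\prod_(1 <= j < N.+1) binomial_mean (p j) n (f j))%:E)%E.
Proof.
move=> f0 fm; have := draw_prod_le p01 (psum N.+1) n f0 fm.
rewrite -lee_fin; apply: le_trans; rewrite -integral_sample; last first.
  by move=> s; apply: prodr_ge0.
rewrite le_eqVlt; apply/orP; left; apply/eqP; apply: eq_integral => w _.
congr EFin; apply: eq_big_nat => j jN; congr f.
by rewrite occ_sample count_clip.
Qed.
End law.

(** * Chernoff bounds *)

(** Everything follows from (1 - x) e^x <= 1. For x >= 0, use it once as it is and once multiplied
    by x; for x < 0, e^x <= 1 / (1 - x) <= 1 + x + x^2. *)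
Lemma expR_le_quad (R : realType) (x : R) :
  expR x <= 1 + x + x ^+ 2 * expR `|x|.
Proof.
have := expR_ge1Dx (- x); rewrite expRN => h.
have e0 := expR_gt0 x; have V : (expR x)^-1 * expR x = 1.
  by rewrite mulVf// gt_eqF.
have {}h := ler_wpM2r (ltW e0) h; rewrite V in h.
have [x0|x0] := leP 0 x.
  have := ler_wpM2l x0 h; rewrite expr2 (ger0_norm x0); lra.
have e1 : 1 <= expR (- x) by have := expR_ge1Dx (- x); lra.
have q : expR x <= 1 + x + x ^+ 2.
  have xx : 0 < 1 - x by lra.
  have : expR x <= (1 - x)^-1 by rewrite -[X in _ <= X]mul1r ler_pdivlMr//; lra.
  move/le_trans; apply; rewrite -[X in X <= _]mul1r ler_pdivrMr// expr2.
  nra.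
apply: le_trans q _; rewrite lerD2l -[X in X <= _]mulr1.
rewrite ler_wpM2l ?sqr_ge0//; have := expR_ge1Dx `|x|; have := normr_ge0 x; lra.
Qed.

Section markov.
Context d (T : measurableType d) (R : realType) (P : probability T R).

Lemma markov_ge0 (f : T -> R) a b : measurable_fun setT f -> (forall w, 0 <= f w) ->
  0 < a -> (\int[P]_w (f w)%:E <= b%:E)%E ->
  (P [set w | (a <= f w)%R] <= (b / a)%:E)%E.
Proof.
move=> mf f0 a0 fb.
have h : (a%:E * P [set w | (a <= f w)%R] <= \int[P]_w (f w)%:E)%E.
  have -> : [set w | (a <= f w)%R] = setT `&` [set w | a%:E <= `|(EFin \o f) w|]%E.
    by rewrite setTI; apply/seteqP; split=> w /=; rewrite lee_fin ger0_norm.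
  have -> : (\int[P]_w (f w)%:E = \int[P]_(w in setT) id `|(EFin \o f) w|)%E.
    by apply: eq_integral => w _ /=; rewrite ger0_norm.
  apply: (@le_integral_comp_abse _ _ _ P setT measurableT (EFin \o f) a id _ _ _ _ a0) => //.
  exact/measurable_EFinP.
by rewrite mulrC EFinM lee_pdivlMl//; exact: (le_trans h fb).
Qed.
End markov.

(** * Laplace transforms of weighted counts of cells *)

Section wcount.
Context d (T : measurableType d) (R : realType) (P : probability T R).
Variables (p : nat -> R) (U : nat -> {RV P >-> nat}).
Hypothesis p01 : forall v, 0 <= p v <= 1.
Hypothesis psum : forall N, \sum_(1 <= v < N) p v <= 1.
Hypothesis hU : iid_sample p U.
Variables (c : nat -> R) (g : nat -> bool) (n : nat).
Hypothesis c0 : forall j, 0 <= c j.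

(** Taking [c = p] and [g] the test for 0 gives the missing mass; [c = 1] gives the occupancy
    counts, and an indicator [c] restricts them to some of the cells. *)
Definition wcount (w : T) : R := tsum (fun j => c j * (g (occ U n j w))%:R).

Definition cell_mean (j : nat) : R := binomial_mean (p j) n (fun k => (g k)%:R).

Definition wmean : R := tsum (fun j => c j * cell_mean j).

Hypothesis sZ : forall w, pos_summable (fun j => c j * (g (occ U n j w))%:R).
Hypothesis sm : pos_summable (fun j => c j * cell_mean j).

Lemma integral_wcount : (\int[P]_w (wcount w)%:E = wmean%:E)%E.
Proof.
rewrite /wmean -tsumE//; under eq_integral do rewrite /wcount -tsumE//.
under eq_integral.
  move=> w _; rewrite -(@nneseries_addn _ (fun j => (c j * (g (occ U n j w))%:R)%:E) 1).
    over.
  by move=> i; rewrite lee_fin mulr_ge0.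
rewrite /= integral_nneseries//; last 2 first.
- move=> j; apply/measurable_EFinP.
  exact: (measurable_occ U (fun h => c (j + 1)%N * (g (h (j + 1)%N))%:R) n).
- by move=> j w _; rewrite lee_fin mulr_ge0.
rewrite -(@nneseries_addn _ (fun j => (c j * cell_mean j)%:E) 1); last first.
  by move=> j; rewrite lee_fin mulr_ge0// bmean_ge0.
apply: eq_eseriesr => j _.
under eq_integral do rewrite EFinM.
rewrite ge0_integralZl_EFin//; last first.
- apply/measurable_EFinP.
  exact: (measurable_occ U (fun h => (g (h (j + 1)%N))%:R : R) n).
rewrite EFinM; congr (_ * _)%E.
by apply: (integral_occ p01 psum hU n (f := fun k => (g k)%:R)); rewrite ?addn1.
Qed.

Lemma mean_wcount : mean P wcount = wmean.
Proof. by rewrite /mean unlock integral_wcount. Qed.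

Hypothesis gm : {homo g : k l / (k <= l)%N >-> k ==> l} \/
  {homo g : k l / (l <= k)%N >-> k ==> l}.

Variables (lam W : R).
Hypothesis hW : forall N, \sum_(1 <= j < N)
  c j ^+ 2 * expR (`|lam| * c j) * cell_mean j <= W.

(** For either sign of [lam], the factors exp(lam c_j g(X_j)) are monotone in one direction common
    to all cells, so the comparison with independent counts applies. Each binomial factor is then
    bounded by [expR_le_quad], and [W] plays the part of a variance. *)
Lemma exp_wcount_partial_le N :
  (\int[P]_w (expR (lam * (\sum_(1 <= j < N.+1) c j * (g (occ U n j w))%:R -
     \sum_(1 <= j < N.+1) c j * cell_mean j)))%:E <= (expR (lam ^+ 2 * W))%:E)%E.
Proof.
set m := \sum_(1 <= j < N.+1) c j * cell_mean j.
pose f j k := expR (lam * (c j * (g k)%:R)).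
have f0 j k : 0 <= f j k by exact: expR_ge0.
have fm : (forall j k, f j k <= f j k.+1) \/ (forall j k, f j k.+1 <= f j k).
  have gk : (forall k, (g k)%:R <= (g k.+1)%:R :> R) \/
            (forall k, (g k.+1)%:R <= (g k)%:R :> R).
    case: gm => h; [left|right] => k.
      by have := h k k.+1 (leqnSn k); case: (g k); case: (g k.+1).
    by have := h k.+1 k (leqnSn k); case: (g k); case: (g k.+1).
  have [l0|l0] := leP 0 lam.
    case: gk => gk; [left|right] => j k; rewrite ler_expR ler_wpM2l//;
    exact: ler_wpM2l.
  case: gk => gk; [right|left] => j k; rewrite ler_expR ler_wnM2l ?(ltW l0)//;
  exact: ler_wpM2l.
have -> : (\int[P]_w (expR (lam * (\sum_(1 <= j < N.+1) c j * (g (occ U n j w))%:R - m)))%:E =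
  (expR (- (lam * m)))%:E * \int[P]_w (\prod_(1 <= j < N.+1) f j (occ U n j w))%:E)%E.
  rewrite -ge0_integralZl_EFin ?expR_ge0//.
  - apply: eq_integral => w _; rewrite -EFinM; congr EFin.
    by rewrite mulrBr addrC expRD; congr (_ * _); rewrite mulr_sumr expR_sum.
  - by move=> w _; rewrite lee_fin prodr_ge0.
  - apply/measurable_EFinP.
    exact: (measurable_occ U (fun h => \prod_(1 <= j < N.+1) f j (h j)) n).
apply: le_trans.
  apply: lee_wpmul2l; first by rewrite lee_fin expR_ge0.
  exact: (integral_prod_occ_le p01 psum hU).
rewrite -EFinM lee_fin.
apply: (@le_trans _ _ (expR (- (lam * m)) * \prod_(1 <= j < N.+1)
   expR (lam * (c j * cell_mean j) + lam ^+ 2 * (c j ^+ 2 * expR (`|lam| * c j) * cell_mean j)))).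
  rewrite ler_wpM2l ?expR_ge0//; apply: ler_prod => j _.
  rewrite bmean_ge0//=.
  (* A function of an indicator is affine in it. *)
  have -> : binomial_mean (p j) n (f j) = 1 + (expR (lam * c j) - 1) * cell_mean j.
    have := bmean_lin (p j) n 1 (expR (lam * c j) - 1) (fun=> 1) (fun k => (g k)%:R).
    rewrite bmean_cst mul1r => <-; apply: eq_bmean => k; rewrite /f; case: (g k).
      by rewrite !mulr1 addrC subrK.
    by rewrite mulr0n !mulr0 expR0 ?mulr1 addr0.
  apply: le_trans (expR_ge1Dx _) _; rewrite ler_expR.
  have b0 : 0 <= cell_mean j by exact: bmean_ge0.
  have := ler_wpM2r b0 (expR_le_quad (lam * c j)).
  rewrite normrM (ger0_norm (c0 j)) exprMn.
  lra.
rewrite -expR_sum -expRD ler_expR big_split/= -!mulr_sumr -/m addKr.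
by rewrite ler_wpM2l ?sqr_ge0.
Qed.

(** Fatou's lemma passes from finitely many cells to all of them. *)
Lemma exp_wcount_le :
  (\int[P]_w (expR (lam * (wcount w - wmean)))%:E <= (expR (lam ^+ 2 * W))%:E)%E.
Proof.
pose F N w := (expR (lam * (\sum_(1 <= j < N.+1) c j * (g (occ U n j w))%:R -
     \sum_(1 <= j < N.+1) c j * cell_mean j)))%:E.
have FE w : limn_einf (F^~ w) = (expR (lam * (wcount w - wmean)))%:E.
  apply: (cvg_limn_einf_sup _).1; apply: cvg_EFin; first exact: nearW.
  apply: (@continuous_cvg _ _ _ _ _ _ expR); first exact: continuous_expR.
  apply: cvgMr; apply: cvgB.
    by rewrite (cvg_shiftS (fun N => \sum_(1 <= j < N) c j * (g (occ U n j w))%:R)); exact: tsum_cvg.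
  by rewrite (cvg_shiftS (fun N => \sum_(1 <= j < N) c j * cell_mean j)); exact: tsum_cvg.
under eq_integral do rewrite -FE.
apply: le_trans (fatou _ _ _ _) _ => //.
- move=> N; apply/measurable_EFinP.
  exact: (measurable_occ U (fun h => expR (lam * (\sum_(1 <= j < N.+1) c j * (g (h j))%:R -
     \sum_(1 <= j < N.+1) c j * cell_mean j))) n).
- by move=> N w _; rewrite lee_fin expR_ge0.
rewrite limn_einf_lim; apply: lime_le; first exact: is_cvg_einfs.
apply: nearW => N; apply: le_trans (exp_wcount_partial_le N).
by apply: ereal_inf_lbound; exists N => /=.
Qed.
End wcount.

Section tail.
Context d (T : measurableType d) (R : realType) (P : probability T R).
Variables (p : nat -> R) (U : nat -> {RV P >-> nat}).

Lemma measurable_occ_set (Q : (nat -> nat) -> Prop) n :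
  measurable [set w | Q (fun j => occ U n j w)].
Proof.
have := @measurable_occ _ _ _ _ U _ _ (fun h => `[< Q h >]) n measurableT [set true] I.
rewrite setTI; congr measurable; apply/seteqP; split=> w /=; first by move/asboolP.
by move=> Qw; apply/asboolP.
Qed.

Hypothesis p01 : forall v, 0 <= p v <= 1.
Hypothesis psum : forall N, \sum_(1 <= v < N) p v <= 1.
Hypothesis hU : iid_sample p U.

(** Markov's inequality for exp(lam Z) and for exp(- lam Z), Z being the centred sum. The bound on
    the Laplace transform is insensitive to the sign of the exponent, hence the factor 2. *)
Lemma wcount_tail (c : nat -> R) (g : nat -> bool) (n : nat) (lam W t : R) :
  (forall j, 0 <= c j) ->
  (forall w, pos_summable (fun j => c j * (g (occ U n j w))%:R)) ->
  pos_summable (fun j => c j * cell_mean p g n j) ->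
  {homo g : k l / (k <= l)%N >-> k ==> l} \/
  {homo g : k l / (l <= k)%N >-> k ==> l} ->
  0 <= lam ->
  (forall N, \sum_(1 <= j < N) c j ^+ 2 * expR (lam * c j) * cell_mean p g n j <= W) ->
  (P [set w | (t < `|wcount U c g n w - wmean p c g n|)%R] <=
   (2 * expR (lam ^+ 2 * W - lam * t))%:E)%E.
Proof.
move=> c0 sZ sm gm l0 hW.
pose Z := wcount U c g n; pose m := wmean p c g n.
pose A s := [set w | expR (lam * t) <= expR (s * (Z w - m))].
have mA s : measurable (A s).
  exact: (measurable_occ_set (fun h => expR (lam * t) <=
    expR (s * (tsum (fun j => c j * (g (h j))%:R) - m))) n).
have PA s : `|s| = lam -> (P (A s) <= (expR (lam ^+ 2 * W - lam * t))%:E)%E.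
  move=> sl; rewrite expRD expRN; apply: markov_ge0; rewrite ?expR_gt0//.
  - exact: (measurable_occ U (fun h => expR (s * (tsum (fun j => c j * (g (h j))%:R) - m))) n).
  - have -> : lam ^+ 2 = s ^+ 2 by rewrite -sl real_normK ?num_real.
    apply: (exp_wcount_le p01 psum hU c0 sZ sm gm).
    by rewrite sl.
apply: (@le_trans _ _ (P (A lam `|` A (- lam)))).
  apply: le_measure; rewrite ?inE.
  - exact: (measurable_occ_set (fun h => t < `|tsum (fun j => c j * (g (h j))%:R) - m|) n).
  - exact: measurableU.
  move=> w /= tw; rewrite /A /= !ler_expR.
  have [Zm|Zm] := leP 0 (Z w - m); [left|right].
    by rewrite ler_wpM2l//; move: tw; rewrite -/(Z w) -/m ger0_norm// => /ltW.
  rewrite mulNr -mulrN ler_wpM2l//.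
  by move: tw; rewrite -/(Z w) -/m ltr0_norm// => /ltW.
apply: le_trans (measureU2 _ _ _) _ => //.
rewrite mulr_natl mulr2n EFinD; apply: leeD; apply: PA.
  by rewrite ger0_norm.
by rewrite normrN ger0_norm.
Qed.
End tail.

(** * Means and deviations of the occupancy counts *)

Section pmf.
Context (R : realType) (p : nat -> R).
Hypothesis p01 : forall v, 0 <= p v <= 1.
Hypothesis hp : is_pmf p.

Let p0 v : 0 <= p v. Proof. by case/andP: (p01 v). Qed.
Let p1 v : p v <= 1. Proof. by case/andP: (p01 v). Qed.
Let q0 v : 0 <= 1 - p v. Proof. by rewrite subr_ge0. Qed.
Let q1 v : 1 - p v <= 1. Proof. by rewrite gerBl. Qed.

Lemma pmf_summable : pos_summable p.
Proof. by case: hp => p_ge0 p_sum; split=> //; rewrite p_sum ltry. Qed.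

Lemma pmf_tsum : tsum p = 1.
Proof. by case: hp => _ p_sum; rewrite /tsum p_sum. Qed.

Lemma pmf_partial N : \sum_(1 <= v < N) p v <= 1.
Proof. by rewrite -pmf_tsum; exact/tsum_partial/pmf_summable. Qed.

Lemma pmf_dominated (a : nat -> R) c : 0 <= c ->
  (forall j, (1 <= j)%N -> 0 <= a j <= c * p j) -> pos_summable a /\ tsum a <= c.
Proof.
move=> c0 ac; have sc := pos_summableZ c0 pmf_summable.
have [||] := @le_tsum _ a (fun j => c * p j) _ _ sc.
- by move=> j /ac /andP[].
- by move=> j /ac /andP[].
by move=> sa; rewrite tsumZ ?pmf_tsum ?mulr1//; exact: pmf_summable.
Qed.

(** For r = 1 this is the mean missing mass E M_n; with the exponent n - r and the factor 'C(n, r),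
    it is the mean number of cells hit exactly r times. *)
Definition tmom (r n : nat) : R := tsum (fun j => p j ^+ r * (1 - p j) ^+ n).

Lemma tmom_summable r n : (0 < r)%N -> pos_summable (fun j => p j ^+ r * (1 - p j) ^+ n).
Proof.
case: r => // r _; apply: (@pmf_dominated _ 1 _ _).1 => // j _.
rewrite mulr_ge0 ?exprn_ge0//= exprS mul1r -mulrA ler_piMr//.
by rewrite mulr_ile1 ?exprn_ge0// exprn_ile1.
Qed.

Lemma tmom_ge0 r n : 0 <= tmom r n.
Proof. by apply: tsum_ge0 => j _; rewrite mulr_ge0// exprn_ge0. Qed.

(** Insert 1 = (1 - p_j) + p_j. For r = 1 this says that E M_n decreases by the second moment, which
    is how EK_2 controls the variation of E M_n. *)
Lemma tmomS r n : (0 < r)%N -> tmom r n = tmom r n.+1 + tmom r.+1 n.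
Proof.
move=> r0; rewrite /tmom -tsumD; try exact: tmom_summable.
by apply: eq_tsum => j _; rewrite !exprS; ring.
Qed.

Lemma tmom_anti r m n : (0 < r)%N -> (m <= n)%N -> tmom r n <= tmom r m.
Proof.
move=> r0 mn; rewrite -(subnK mn); elim: (n - m)%N => [|k IH] //.
by apply: le_trans IH; rewrite addSn [leRHS]tmomS// lerDl tmom_ge0.
Qed.

Lemma cell_mean_ge0 g n j : 0 <= cell_mean p g n j.
Proof. exact: bmean_ge0. Qed.

Lemma cell_mean_le1 g n j : cell_mean p g n j <= 1.
Proof.
rewrite -(bmean_cst (p j) n 1); apply: le_bmean => // k.
by case: (g k).
Qed.

Lemma cell_mean_le (g h : pred nat) n j : (forall k, g k -> h k) ->
  cell_mean p g n j <= cell_mean p h n j.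
Proof.
move=> gh; apply: le_bmean => // k; have := gh k.
by case: (g k) => [->//|_]; case: (h k).
Qed.

(** As [g] excludes 0, a cell contributes at most P(X_j >= 1) <= n p_j. *)
Lemma mean_summable (c : nat -> R) g n : (forall j, 0 <= c j <= 1) -> g 0%N = false ->
  pos_summable (fun j => c j * cell_mean p g n j).
Proof.
move=> c01 g0; apply: (@pmf_dominated _ n%:R _ _).1 => // j _.
have /andP[c0 c1] := c01 j.
rewrite mulr_ge0 ?cell_mean_ge0//=.
apply: (@le_trans _ _ (cell_mean p g n j)); first by rewrite ler_piMl ?cell_mean_ge0.
apply: le_trans (bmean_ge1_le n (p01 j)).
by apply: (@cell_mean_le g (fun k => 1 <= k)%N) => -[|k] //; rewrite g0.
Qed.

Section sample.
Context d (T : measurableType d) (P : probability T R) (U : nat -> {RV P >-> nat}).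
Hypothesis hU : iid_sample p U.

Lemma sum_occ_le n N w : (\sum_(1 <= j < N) occ U n j w <= n)%N.
Proof.
rewrite /occ exchange_big/= -[leqRHS]card_ord -sum1_card; apply: leq_sum => i _.
have [UN|UN] := boolP (U i w \in index_iota 1 N).
  rewrite (bigD1_seq (U i w))//= ?iota_uniq// eqxx big1// => j /negPf.
  by rewrite eq_sym => ->.
rewrite big_seq_cond big1// => j /andP[jN _]; case: eqP => // Uj.
by rewrite Uj jN in UN.
Qed.

Lemma occ_summable (c : nat -> R) g n w : (forall j, 0 <= c j <= 1) -> g 0%N = false ->
  pos_summable (fun j => c j * (g (occ U n j w))%:R).
Proof.
move=> c01 g0; apply: (@tsum_le _ _ n%:R _ _).1 => [j _|N].
  by rewrite mulr_ge0//; case/andP: (c01 j).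
apply: (@le_trans _ _ (\sum_(1 <= j < N) (occ U n j w)%:R)).
  apply: ler_sum_nat => j _; have /andP[c0 c1] := c01 j.
  apply: (@le_trans _ _ (g (occ U n j w))%:R); first by rewrite ler_piMl.
  by rewrite ler_nat; case: (occ _ _ _ _) => [|k]; [rewrite g0|case: (g _)].
by rewrite -natr_sum ler_nat sum_occ_le.
Qed.

(** Weights and [lam] at most 1 give c_j^2 exp(lam c_j) <= e c_j, so e times the mean serves as
    variance. *)
Lemma occ_tail (c : nat -> R) (g : nat -> bool) (n : nat) (lam V t : R) :
  (forall j, 0 <= c j <= 1) -> g 0%N = false -> {homo g : k l / (k <= l)%N >-> k ==> l} ->
  0 <= lam <= 1 -> wmean p c g n <= V ->
  (P [set w | (t < `|wcount U c g n w - wmean p c g n|)%R] <=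
   (2 * expR (lam ^+ 2 * (expR 1 * V) - lam * t))%:E)%E.
Proof.
move=> c01 g0 gm /andP[l0 l1] cV.
have c0 j : 0 <= c j by case/andP: (c01 j).
apply: (wcount_tail p01 pmf_partial hU) => //.
- by move=> w; exact: occ_summable.
- exact: mean_summable.
- by left.
move=> N; apply: (@le_trans _ _ (expR 1 * \sum_(1 <= j < N) c j * cell_mean p g n j)).
  rewrite mulr_sumr; apply: ler_sum_nat => j _.
  have /andP[_ c1] := c01 j.
  have e : expR (lam * c j) <= expR 1 by rewrite ler_expR mulr_ile1.
  rewrite mulrA ler_wpM2r ?cell_mean_ge0// mulrC.
  by apply: ler_pM => //; rewrite ?expR_ge0 ?exprn_ge0// expr2 ler_piMl.
rewrite ler_wpM2l ?expR_ge0//; apply: le_trans cV.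
by apply: tsum_partial; exact: mean_summable.
Qed.

(** The parameter of the exponential is the integer [m], since e^p (1 - p) <= 1 lets [m] of the [n]
    factors 1 - p_j absorb exp(m p_j). What remains of the variance is the second moment at n -
    m. *)
Lemma missing_tail (n m : nat) (t : R) : (m <= n)%N ->
  (P [set w | (t < `|missing_mass p U n w - tmom 1 n|)%R] <=
   (2 * expR (m%:R ^+ 2 * tmom 2 (n - m) - m%:R * t))%:E)%E.
Proof.
move=> mn; have cE j : cell_mean p (eq_op^~ 0%N) n j = (1 - p j) ^+ n by exact: bmean_eq0.
have -> : tmom 1 n = wmean p p (eq_op^~ 0%N) n.
  by apply: eq_tsum => j _; rewrite cE expr1.
apply: (wcount_tail p01 pmf_partial hU) => //.
- move=> w; apply: (@pmf_dominated _ 1 _ _).1 => // j _.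
  by rewrite mul1r mulr_ge0//= ler_piMr// lern1 leq_b1.
- have := tmom_summable n (ltn0Sn 0); congr pos_summable.
  by apply/funext => j; rewrite cE expr1.
- by right=> -[|k] [|l].
move=> N; apply: le_trans (tsum_partial N (tmom_summable (n - m) (ltn0Sn 1))).
apply: ler_sum_nat => j _; rewrite cE -mulrA ler_wpM2l ?exprn_ge0//.
have -> : (1 - p j) ^+ n = (1 - p j) ^+ (n - m) * (1 - p j) ^+ m.
  by rewrite -exprD subnK.
rewrite mulrCA ler_piMr ?exprn_ge0//.
rewrite expRM_natl -exprMn exprn_ile1// ?mulr_ge0 ?expR_ge0//.
apply: (@le_trans _ _ (expR (p j) * expR (- p j))).
  by rewrite ler_wpM2l ?expR_ge0//; exact: expR_ge1Dx.
by rewrite -expRD subrr expR0.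
Qed.

Lemma mean_occ_count n r : (0 < r)%N ->
  mean P (occ_count U n r) = tsum (cell_mean p (eq_op^~ r) n).
Proof.
case: r => // r _.
have -> : occ_count U n r.+1 = wcount U (fun=> 1) (eq_op^~ r.+1) n.
  by apply/funext => w; apply: eq_tsum => j _; rewrite mul1r.
rewrite (mean_wcount p01 pmf_partial hU) => //.
- by apply: eq_tsum => j _; rewrite mul1r.
- by move=> w; apply: (@occ_summable (fun=> 1) (eq_op^~ r.+1)) => // j; rewrite ler01 lexx.
- by apply: (@mean_summable (fun=> 1) (eq_op^~ r.+1)) => // j; rewrite ler01 lexx.
Qed.

Lemma mean_occ_count_ge n r : (0 < r)%N ->
  mean P (occ_count_ge U n r) = tsum (cell_mean p (leq r) n).
Proof.
case: r => // r _.
have -> : occ_count_ge U n r.+1 = wcount U (fun=> 1) (leq r.+1) n.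
  by apply/funext => w; apply: eq_tsum => j _; rewrite mul1r.
rewrite (mean_wcount p01 pmf_partial hU) => //.
- by apply: eq_tsum => j _; rewrite mul1r.
- by move=> w; apply: (@occ_summable (fun=> 1) (leq r.+1)) => // j; rewrite ler01 lexx.
- by apply: (@mean_summable (fun=> 1) (leq r.+1)) => // j; rewrite ler01 lexx.
Qed.

Lemma mean_K1 n : mean P (occ_count U n 1) = n%:R * tmom 1 n.-1.
Proof.
rewrite mean_occ_count// -tsumZ//; last exact: tmom_summable.
by apply: eq_tsum => j _; rewrite /cell_mean bmean_eq1 expr1 mulrA.
Qed.

Lemma mean_K2 n : mean P (occ_count U n 2) = 'C(n, 2)%:R * tmom 2 n.-2.
Proof.
rewrite mean_occ_count// -tsumZ//; last exact: tmom_summable.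
by apply: eq_tsum => j _; rewrite /cell_mean bmean_eq2 mulrA.
Qed.

Lemma mean_missing n : mean P (missing_mass p U n) = tmom 1 n.
Proof.
have -> : missing_mass p U n = wcount U p (eq_op^~ 0%N) n by [].
have cE j : cell_mean p (eq_op^~ 0%N) n j = (1 - p j) ^+ n by exact: bmean_eq0.
rewrite (mean_wcount p01 pmf_partial hU) => //.
- by apply: eq_tsum => j _; rewrite cE expr1.
- move=> w; apply: (@pmf_dominated _ 1 _ _).1 => // j _.
  by rewrite mul1r mulr_ge0//= ler_piMr// lern1 leq_b1.
- have := tmom_summable n (ltn0Sn 0); congr pos_summable.
  by apply/funext => j; rewrite cE expr1.
Qed.
End sample.
End pmf.

(** * Concentration of the missing mass and of the number of singletons *)

Section concentration.
Context (R : realType) (p : nat -> R).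
Hypothesis p01 : forall v, 0 <= p v <= 1.
Hypothesis hp : is_pmf p.

Let p0 v : 0 <= p v. Proof. by case/andP: (p01 v). Qed.
Let q0 v : 0 <= 1 - p v. Proof. by rewrite subr_ge0; case/andP: (p01 v). Qed.

Local Notation m1 := (tmom p 1).
Local Notation m2 := (tmom p 2).

Variables (A : R) (n0 : nat).
Hypothesis A0 : 0 < A.
Hypothesis m2A : forall n, (n0 <= n)%N -> n.+1%:R * m2 n <= A * m1 n.+1.

(** By [tmomS] and [m2A], one step back multiplies the mean missing mass by at most 1 + A / (k + 1),
    hence by at most exp(A / (k + 1)). *)
Lemma m1_growth k i : (n0 <= k)%N -> m1 k <= expR (A * i%:R / k.+1%:R) * m1 (k + i)%N.
Proof.
move=> n0k; elim: i => [|i IH]; first by rewrite mulr0 mul0r expR0 mul1r addn0.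
apply: le_trans IH _; rewrite -[i.+1%:R]natr1 mulrDr mulr1 mulrDl expRD -[leRHS]mulrA.
rewrite ler_wpM2l ?expR_ge0// addnS.
apply: (@le_trans _ _ ((1 + A / k.+1%:R) * m1 (k + i).+1)); last first.
  by rewrite ler_wpM2r ?tmom_ge0//; exact: expR_ge1Dx.
rewrite tmomS// mulrDl mul1r lerD2l.
rewrite mulrAC ler_pdivlMr// mulrC; apply: le_trans (m2A _); last by lia.
by rewrite ler_wpM2r ?tmom_ge0// ler_nat ltnS leq_addr.
Qed.

Lemma m1_pred_le n : (n0 < n)%N -> m1 n <= m1 n.-1 <= (1 + A / n%:R) * m1 n.
Proof.
case: n => // n n0n /=; rewrite tmom_anti//= tmomS// mulrDl mul1r lerD2l.
by rewrite mulrAC ler_pdivlMr// mulrC m2A.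
Qed.

Section sample.
Context d (T : measurableType d) (P : probability T R) (U : nat -> {RV P >-> nat}).
Hypothesis hU : iid_sample p U.

(** [missing_tail] is used with m of order n: a small enough fraction makes the quadratic term at
    most half of the linear one, and the exponent is then of order n E M_n. The quantity (n + 1) E
    M_n is the mean of K_1 for a sample of size n + 1. *)
Lemma missing_conc (eps : R) : 0 < eps -> exists2 c : R, 0 < c &
  \forall n \near \oo,
  (P [set w | (eps * m1 n < `|missing_mass p U n w - m1 n|)%R] <=
   (2 * expR (- c * (n.+1%:R * m1 n)))%:E)%E.
Proof.
(* [B] satisfies (n - m + 1) m2(n - m) <= B m1(n) whenever 2 m <= n: the growth from n - m to n
   costs at most the factor e^A. With m = n / q and 4 B <= eps q, this gives m m2(n - m) <= (eps /
   2) m1(n). *)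
move=> e0; pose B := A * expR A.
have B0 : 0 < B by rewrite mulr_gt0 ?expR_gt0.
pose q := (Num.truncn (4 * B / eps)).+2.
have q0' : 0 < q%:R :> R by rewrite ltr0n.
have qB : 4 * B <= eps * q%:R.
  rewrite [leRHS]mulrC -ler_pdivrMr// ltW//; apply: lt_le_trans (truncnS_gt _) _.
  by rewrite ler_nat.
exists (eps / (4 * q%:R)); first by rewrite divr_gt0// mulr_gt0.
near=> n.
have nq : (q <= n)%N by near: n; exact: nbhs_infty_ge.
have nn0 : (2 * n0 <= n)%N by near: n; exact: nbhs_infty_ge.
pose m := (n %/ q)%N.
have m2n : (2 * m <= n)%N by rewrite /m /q; have := leq_trunc_div n (Num.truncn (4 * B / eps)).+2; nia.
have mn : (m <= n)%N by lia.
apply: le_trans (missing_tail p01 hp hU _ mn) _.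
rewrite lee_fin ler_pM2l// ler_expR.
set X := m2 (n - m); set Y := m1 n.
have X0 : 0 <= X by exact: tmom_ge0.
have Y0 : 0 <= Y by exact: tmom_ge0.
have XY : (n - m).+1%:R * X <= B * Y.
  apply: le_trans (m2A _) _; first by lia.
  rewrite -mulrA ler_pM2l//.
  apply: le_trans (tmom_anti p01 hp _ (leqnSn _)) _ => //.
  apply: le_trans (m1_growth m _) _; first by lia.
  rewrite subnK// ler_wpM2r// ler_expR -mulrA ler_piMr ?(ltW A0)//.
  by rewrite ler_pdivrMr// mul1r ler_nat; lia.
have mq : m%:R * q%:R <= 2 * (n - m).+1%:R :> R.
  by rewrite -!natrM ler_nat; have := leq_trunc_div n q; rewrite -/m; lia.
have nmq : n.+1%:R <= 2 * (m%:R * q%:R) :> R.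
  rewrite -!natrM ler_nat; have := ltn_ceil n (ltn0Sn (Num.truncn (4 * B / eps)).+1).
  rewrite -/q -/m; have : (1 <= m)%N by rewrite /m divn_gt0.
  nia.
have m0 : 0 <= m%:R :> R by [].
have h1 : m%:R * q%:R * X <= 2 * B * Y.
  apply: le_trans (ler_wpM2r X0 mq) _; by rewrite -!(mulrA 2) ler_pM2l.
have h2 : m%:R * X <= eps / 2 * Y.
  rewrite -(ler_pM2r q0'); apply: (@le_trans _ _ (2 * B * Y)).
    by rewrite mulrAC.
  have := ler_wpM2r Y0 qB; lra.
have h3 := ler_wpM2l m0 h2.
have h4 : eps / (4 * q%:R) * (n.+1%:R * Y) <= m%:R * (eps / 2 * Y).
  have -> : eps / (4 * q%:R) * (n.+1%:R * Y) = (eps * Y) * (n.+1%:R / (4 * q%:R)).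
    by rewrite mulrAC mulrA; ring.
  have -> : m%:R * (eps / 2 * Y) = (eps * Y) * (m%:R / 2) by ring.
  rewrite ler_wpM2l ?mulr_ge0 ?(ltW e0)// ler_pdivrMr ?mulr_gt0//.
  lra.
rewrite mulNr expr2 -mulrA; lra.
Unshelve. all: by end_near. Qed.

Let hit_ge1 := (fun k => (1 <= k)%N).
Let hit_ge2 := (fun k => (2 <= k)%N).
Let hit_1 := (fun k => k == 1%N).

(** The indicator of k = 1 is not monotone; those of k >= 1 and k >= 2 are, and their tails are
    treated separately. *)
Lemma wcount1E (c : nat -> R) n w : (forall j, 0 <= c j <= 1) ->
  wcount U c hit_1 n w = wcount U c hit_ge1 n w - wcount U c hit_ge2 n w.
Proof.
move=> c01; apply/eqP; rewrite eq_sym subr_eq -tsumD; try exact: occ_summable.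
apply/eqP/eq_tsum => j _; rewrite -mulrDr -natrD.
by rewrite /hit_1 /hit_ge1 /hit_ge2; case: (occ U n j w) => [|[|k]].
Qed.

Lemma wmean1E (c : nat -> R) n : (forall j, 0 <= c j <= 1) ->
  wmean p c hit_1 n = wmean p c hit_ge1 n - wmean p c hit_ge2 n.
Proof.
move=> c01; apply/eqP; rewrite eq_sym subr_eq -tsumD; try exact: (mean_summable p01 hp).
apply/eqP/eq_tsum => j _; rewrite -mulrDr; congr (_ * _).
rewrite /cell_mean -[X in _ = X + _]mul1r -[X in _ = _ + X]mul1r -bmean_lin.
apply: eq_bmean => k; rewrite !mul1r -natrD.
by rewrite /hit_1 /hit_ge1 /hit_ge2; case: k => [|[|k]].
Qed.

Lemma wcount1_tail (c : nat -> R) (n : nat) (lam V t : R) :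
  (forall j, 0 <= c j <= 1) -> 0 <= lam <= 1 -> wmean p c hit_ge1 n <= V ->
  (P [set w | (t < `|wcount U c hit_1 n w - wmean p c hit_1 n|)%R] <=
   (4 * expR (lam ^+ 2 * (expR 1 * V) - lam * (t / 2)))%:E)%E.
Proof.
move=> c01 l01 cV.
have cV2 : wmean p c hit_ge2 n <= V.
  apply: le_trans cV; have := mean_summable p01 hp n c01 (erefl : hit_ge1 0%N = false).
  move/(le_tsum _ _) => h; apply: (h _ _ _).2 => j _; have /andP[c0 _] := c01 j.
    by rewrite mulr_ge0// bmean_ge0.
  by rewrite ler_wpM2l//; apply: cell_mean_le => // k; exact: ltnW.
pose F g := [set w | (t / 2 < `|wcount U c g n w - wmean p c g n|)%R].
have mF g : measurable (F g).
  exact: (measurable_occ_set U (fun h => t / 2 <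
     `|tsum (fun j => c j * (g (h j))%:R) - wmean p c g n|) n).
apply: (@le_trans _ _ (P (F hit_ge1 `|` F hit_ge2))).
  apply: le_measure; rewrite ?inE.
  - exact: (measurable_occ_set U (fun h => t <
     `|tsum (fun j => c j * (hit_1 (h j))%:R) - wmean p c hit_1 n|) n).
  - exact: measurableU.
  move=> w /=; rewrite wcount1E// wmean1E// /F /= => tw.
  apply/orP; rewrite -[_ || _]negbK negb_or -!leNgt; apply/negP => /andP[h1 h2].
  move: tw; apply/negP; rewrite -leNgt.
  set x1 := wcount U c hit_ge1 n w in h1 *; set x2 := wcount U c hit_ge2 n w in h2 *.
  set y1 := wmean p c hit_ge1 n in h1 *; set y2 := wmean p c hit_ge2 n in h2 *.
  have -> : x1 - x2 - (y1 - y2) = (x1 - y1) - (x2 - y2) by ring.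
  by apply: le_trans (ler_normB _ _) _; lra.
apply: le_trans (measureU2 _ _ _) _ => //.
have -> : (4 : R) = 2 + 2 by lra.
rewrite mulrDl EFinD; apply: leeD; apply: occ_tail => //.
- by move=> [|k] [|l].
- by move=> [|[|k]] [|[|l]].
Qed.

Lemma count1_conc (C eps : R) : 0 < eps -> 0 <= C -> exists2 c : R, 0 < c &
  forall n, mean P (occ_count_ge U n 1) <= C * mean P (occ_count U n 1) ->
  (P [set w | (eps * mean P (occ_count U n 1) <
     `|occ_count U n 1 w - mean P (occ_count U n 1)|)%R] <=
   (4 * expR (- c * mean P (occ_count U n 1)))%:E)%E.
Proof.
move=> e0 C0; pose e1 : R := expR 1; have e10 : 0 < e1 by exact: expR_gt0.
(* This makes lam e C at most eps / 4, half of the linear coefficient eps / 2 left by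
   [wcount1_tail]. The summand 1 keeps the denominator positive when C = 0, and the minimum with 1
   below is required by [occ_tail]. *)
pose l0 := eps / (4 * (e1 * (C + 1))).
have l00 : 0 < l0 by rewrite divr_gt0 ?mulr_gt0//; lra.
pose lam := Num.min 1 l0.
have lam0 : 0 < lam by rewrite /lam lt_min ltr01.
exists (lam * eps / 4); first by rewrite !mulr_gt0.
move=> n; rewrite (mean_occ_count_ge p01 hp hU)// => geC.
have := @wcount1_tail (fun=> 1) n lam (C * mean P (occ_count U n 1))
  (eps * mean P (occ_count U n 1)).
have -> : wmean p (fun=> 1) hit_1 n = mean P (occ_count U n 1).
  rewrite (mean_occ_count p01 hp hU)//; apply: eq_tsum => j _; exact: mul1r.
have -> : wcount U (fun=> 1) hit_1 n = occ_count U n 1.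
  by apply/funext => w; apply: eq_tsum => j _; rewrite mul1r.
have ce : wmean p (fun=> 1) hit_ge1 n <= C * mean P (occ_count U n 1).
  by apply: le_trans geC; rewrite le_eqVlt; apply/orP; left; apply/eqP/eq_tsum => j _; exact: mul1r.
have l1 : 0 <= lam <= 1 by rewrite (ltW lam0) /lam ge_min lexx.
move=> /(_ (fun j => _) l1 ce) h; apply: le_trans (h _) _; first by rewrite ler01 lexx.
rewrite lee_fin ler_pM2l// ler_expR -/e1.
set a := mean _ _; have a0 : 0 <= a.
  by rewrite /a (mean_K1 p01 hp hU) mulr_ge0// tmom_ge0.
have : lam * (e1 * (C + 1)) <= eps / 4.
  have -> : eps / 4 = l0 * (e1 * (C + 1)).
    rewrite /l0; have : 0 < e1 * (C + 1) by rewrite mulr_gt0//; lra.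
    by move: (e1 * (C + 1)) => x x0; rewrite invfM mulrA mulfVK// gt_eqF.
  by rewrite ler_wpM2r ?mulr_ge0 ?(ltW e10)//; [lra|rewrite /lam ge_min lexx orbT].
move=> hl; have := ler_wpM2l (mulr_ge0 (ltW lam0) a0) hl.
have : 0 <= lam ^+ 2 * e1 * a by apply: mulr_ge0 => //; apply: mulr_ge0; [exact: sqr_ge0|exact: ltW].
rewrite expr2; lra.
Qed.

(* Chernoff only sees monotone indicators, and without control of the cells hit
   at least twice they are too large; the heavy cells [p j > L / n] are therefore
   discarded by Markov's inequality. *)
Lemma count1_conc_weak (eps eta : R) : 0 < eps -> 0 < eta -> exists2 c : R, 0 < c &
  \forall n \near \oo, 0 < mean P (occ_count U n 1) ->
  (P [set w | (eps * mean P (occ_count U n 1) <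
     `|occ_count U n 1 w - mean P (occ_count U n 1)|)%R] <=
   (4 * expR (- c * mean P (occ_count U n 1)) + eta)%:E)%E.
Proof.
move=> e0 eta0; pose e1 : R := expR 1; have e10 : 0 < e1 by exact: expR_gt0.
(* The first summand makes the mean count of singletons in heavy cells at most (eps / 4) EK_1; the
   second makes Markov's bound for that count at most eta. *)
pose Lt := 4 * A / eps + 4 * A / (eps * eta).
have Lt0 : 0 < Lt by rewrite addr_gt0// divr_gt0 ?mulr_gt0.
have [L L0 LtL] : exists2 L : nat, 0 < L%:R :> R & Lt <= L%:R.
  by exists (Num.truncn Lt).+1; rewrite ?ltr0n// ltW// truncnS_gt.
have u1 : 0 < 4 * A / eps by rewrite divr_gt0 ?mulr_gt0.
have u2 : 0 < 4 * A / (eps * eta) by rewrite divr_gt0 ?mulr_gt0.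
have AL1 : A / L%:R <= eps / 4.
  have : 4 * A / eps <= L%:R by apply: le_trans LtL; rewrite /Lt lerDl ltW.
  by rewrite ler_pdivrMr// ler_pdivrMr// => h; lra.
have AL2 : A / L%:R <= eta * (eps / 4).
  have : 4 * A / (eps * eta) <= L%:R by apply: le_trans LtL; rewrite /Lt lerDr ltW.
  by rewrite ler_pdivrMr ?mulr_gt0// ler_pdivrMr// => h; lra.
(* On the light cells, P(X_j >= 1) <= n p_j <= e^(2 L) P(X_j = 1), so all hit light cells together
   are of order EK_1. *)
pose K : R := expR (2 * L%:R); have K0 : 0 < K by exact: expR_gt0.
pose l0 := eps / (8 * (e1 * K)).
have l00 : 0 < l0 by rewrite divr_gt0 ?mulr_gt0.
pose lam := Num.min 1 l0.
have lam0 : 0 < lam by rewrite /lam lt_min ltr01.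
have l1 : 0 <= lam <= 1 by rewrite (ltW lam0) /lam ge_min lexx.
exists (lam * eps / 8); first by rewrite !mulr_gt0.
near=> n; set a := mean P _ => a0.
have nL : (2 * L <= n)%N by near: n; exact: nbhs_infty_ge.
have nn0 : (n0 < n)%N by near: n; exact: nbhs_infty_gt.
have n_gt0 : (0 < n)%N by exact: leq_ltn_trans nn0.
have n0' : 0 < n%:R :> R by rewrite ltr0n.
have aE : a = n%:R * m1 n.-1 by rewrite /a (mean_K1 p01 hp hU).
(* [c] selects the light cells and [c'] the heavy ones. *)
pose c j : R := (p j <= L%:R / n%:R)%R%:R.
pose c' j : R := 1 - c j.
have c01 j : 0 <= c j <= 1 by rewrite /c ler0n lern1 leq_b1.
have c'01 j : 0 <= c' j <= 1 by have := c01 j; rewrite /c'; lra.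
have sK1 : wmean p (fun=> 1) hit_1 n = a.
  by rewrite /a (mean_occ_count p01 hp hU)//; apply: eq_tsum => j _; exact: mul1r.
have cellE j : cell_mean p hit_1 n j = n%:R * p j * (1 - p j) ^+ n.-1.
  exact: bmean_eq1.
have sa : pos_summable (cell_mean p hit_1 n).
  have := @mean_summable _ p p01 hp (fun=> 1) hit_1 n; rewrite /=.
  move=> /(_ _ _)-h; have {h}h := h (fun j => _) erefl.
  suff -> : cell_mean p hit_1 n = (fun j => 1 * cell_mean p hit_1 n j).
    by apply: h; rewrite ler01 lexx.
  by apply/funext => j; rewrite mul1r.
have aT : tsum (cell_mean p hit_1 n) = a.
  by rewrite -sK1; apply: eq_tsum => j _; rewrite mul1r.
have cV : wmean p c hit_ge1 n <= K * a.
  rewrite -aT -tsumZ ?(ltW K0)//; apply: (le_tsum _ _ (pos_summableZ (ltW K0) sa)).2 => j _.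
    by have /andP[? _] := c01 j; rewrite mulr_ge0// bmean_ge0.
  rewrite /c; case: (leP (p j) (L%:R / n%:R)) => pL; last first.
    by rewrite mulr0n mul0r mulr_ge0 ?(ltW K0)// bmean_ge0.
  rewrite mulr1n mul1r cellE; apply: le_trans (bmean_ge1_le n (p01 j)) _.
  rewrite mulrCA ler_peMr ?mulr_ge0//.
  have pn : n%:R * p j <= L%:R by rewrite mulrC -ler_pdivlMr.
  (* For p <= 1/2, (1 + 2 p) (1 - p) >= 1, so that (1 - p)^-1 <= e^(2 p). *)
  have p12 : p j <= 1 / 2.
    rewrite -(ler_pM2l n0'); apply: le_trans pn _.
    by rewrite mulrA mulr1 ler_pdivlMr// mulrC -natrM ler_nat.
  apply: (@le_trans _ _ (expR (2 * p j) ^+ n.-1 * (1 - p j) ^+ n.-1)).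
    rewrite -exprMn exprn_ege1//.
    apply: (@le_trans _ _ ((1 + 2 * p j) * (1 - p j))).
      by have := p0 j; nra.
    by rewrite ler_wpM2r//; exact: expR_ge1Dx.
  rewrite ler_wpM2r ?exprn_ge0// -expRM_natl ler_expR.
  rewrite mulrCA ler_pM2l//; apply: le_trans pn.
  by rewrite ler_wpM2r// ler_nat leq_pred.
(* A heavy cell has n p_j / L >= 1; inserting this factor turns the first moment into the second,
   which [m2A] bounds. *)
have c'V : wmean p c' hit_1 n <= A / L%:R * a.
  have s2 := tmom_summable p01 hp n.-1 (ltn0Sn 1).
  have C0 : 0 <= n%:R ^+ 2 / L%:R :> R by rewrite divr_ge0 ?exprn_ge0// ltW.
  apply: (@le_trans _ _ (n%:R ^+ 2 / L%:R * m2 n.-1)).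
    rewrite -tsumZ//; apply: (le_tsum _ _ (pos_summableZ C0 s2)).2 => j _.
      by have /andP[? _] := c'01 j; rewrite mulr_ge0// bmean_ge0.
    rewrite /c' /c cellE; case: (leP (p j) (L%:R / n%:R)) => pL.
      by rewrite mulr1n subrr mul0r !mulr_ge0 ?exprn_ge0// invr_ge0 ltW.
    rewrite mulr0n subr0 mul1r; have -> : n%:R ^+ 2 / L%:R * (p j ^+ 2 * (1 - p j) ^+ n.-1) =
      (n%:R * p j * (1 - p j) ^+ n.-1) * (n%:R * p j / L%:R) by rewrite !expr2; ring.
    rewrite ler_peMr ?mulr_ge0 ?exprn_ge0//.
    by rewrite ler_pdivlMr// mul1r mulrC -ler_pdivrMr// ltW.
  have := @m2A n.-1; rewrite prednK// -ltnS prednK// => /(_ nn0) h.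
  have {}h := le_trans h (ler_wpM2l (ltW A0) (tmom_anti p01 hp (ltn0Sn 0) (leq_pred n))).
  have -> : n%:R ^+ 2 / L%:R * m2 n.-1 = (n%:R / L%:R) * (n%:R * m2 n.-1) by rewrite expr2; ring.
  rewrite aE; have -> : A / L%:R * (n%:R * m1 n.-1) = (n%:R / L%:R) * (A * m1 n.-1) by ring.
  by rewrite ler_wpM2l// divr_ge0// ltW.
pose B1 := [set w | (eps / 2 * a < `|wcount U c hit_1 n w - wmean p c hit_1 n|)%R].
pose B2 := [set w | (eps / 4 * a <= wcount U c' hit_1 n w)%R].
have mB1 : measurable B1.
  exact: (measurable_occ_set U (fun h => eps / 2 * a <
     `|tsum (fun j => c j * (hit_1 (h j))%:R) - wmean p c hit_1 n|) n).
have mB2 : measurable B2.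
  exact: (measurable_occ_set U (fun h => eps / 4 * a <=
     tsum (fun j => c' j * (hit_1 (h j))%:R)) n).
apply: (@le_trans _ _ (P (B1 `|` B2))).
  apply: le_measure; rewrite ?inE.
  - exact: (measurable_occ_set U (fun h => eps * a <
     `|fine (\sum_(1 <= j <oo) ((h j == 1%N)%:R)%:E)%E - a|) n).
  - exact: measurableU.
  move=> w /= tw; rewrite /B1 /B2 /=.
  apply/orP; rewrite -[_ || _]negbK negb_or -!(leNgt, ltNge); apply/negP => /andP[h1 h2].
  have KE : occ_count U n 1 w = wcount U c hit_1 n w + wcount U c' hit_1 n w.
    rewrite -tsumD; try exact: occ_summable.
    by apply: eq_tsum => j _; rewrite -mulrDl /c' addrC subrK mul1r.
  have aE' : a = wmean p c hit_1 n + wmean p c' hit_1 n.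
    rewrite -sK1 -tsumD; try exact: (mean_summable p01 hp).
    by apply: eq_tsum => j _; rewrite -mulrDl /c' [c j + _]addrC subrK.
  have w0 : 0 <= wcount U c' hit_1 n w.
    by apply: tsum_ge0 => j _; have /andP[? _] := c'01 j; rewrite mulr_ge0.
  have m0 : 0 <= wmean p c' hit_1 n.
    by apply: tsum_ge0 => j _; have /andP[? _] := c'01 j; rewrite mulr_ge0// bmean_ge0.
  have ma : wmean p c' hit_1 n <= eps / 4 * a.
    by apply: le_trans c'V _; rewrite ler_wpM2r// ltW.
  move: tw; rewrite KE; apply/negP; rewrite -leNgt.
  rewrite {1}aE'.
  set x := wcount U c hit_1 n w in h1 *; set x' := wcount U c' hit_1 n w in h2 w0 *.
  set y := wmean p c hit_1 n in h1 *; set y' := wmean p c' hit_1 n in ma m0 *.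
  have -> : x + x' - (y + y') = (x - y) + (x' - y') by ring.
  apply: le_trans (ler_normD _ _) _.
  (* Both the heavy count and its mean lie between 0 and eps a / 4. *)
  have : `|x' - y'| <= eps / 4 * a by rewrite ler_norml; lra.
  have : 0 < eps * a by rewrite mulr_gt0.
  lra.
apply: le_trans (measureU2 _ _ _) _ => //.
rewrite EFinD; apply: leeD.
  apply: le_trans (wcount1_tail _ c01 l1 cV) _.
  rewrite lee_fin ler_pM2l// ler_expR -/e1.
  have : lam * (e1 * K) <= eps / 8.
    have -> : eps / 8 = l0 * (e1 * K).
      rewrite /l0; have : 0 < e1 * K by rewrite mulr_gt0.
      by move: (e1 * K) => x x0; rewrite invfM mulrA mulfVK// gt_eqF.
    by rewrite ler_wpM2r ?mulr_ge0 ?(ltW e10) ?(ltW K0)// /lam ge_min lexx orbT.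
  move=> hl; have := ler_wpM2l (mulr_ge0 (ltW lam0) (ltW a0)) hl.
  rewrite expr2; lra.
apply: le_trans (markov_ge0 (b := wmean p c' hit_1 n) _ _ _ _) _.
- exact: (measurable_occ U (fun h => tsum (fun j => c' j * (hit_1 (h j))%:R)) n).
- by move=> w; apply: tsum_ge0 => j _; have /andP[? _] := c'01 j; rewrite mulr_ge0.
- by rewrite mulr_gt0// divr_gt0.
- rewrite (integral_wcount p01 (pmf_partial hp) hU)//.
  + by move=> j; case/andP: (c'01 j).
  + by move=> w; exact: occ_summable.
  + exact: (mean_summable p01 hp).
- rewrite lee_fin ler_pdivrMr ?mulr_gt0// mulrA.
  by apply: le_trans c'V _; rewrite ler_wpM2r// ltW.
Unshelve. all: by end_near. Qed.
End sample.
End concentration.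

(** * Dyadic blocks of cells *)

Section counting.
Context (R : realType) (p : nat -> R).
Hypothesis p01 : forall v, 0 <= p v <= 1.
Hypothesis hp : is_pmf p.

Let p0 v : 0 <= p v. Proof. by case/andP: (p01 v). Qed.
Let q0 v : 0 <= 1 - p v. Proof. by rewrite subr_ge0; case/andP: (p01 v). Qed.

Lemma count_summable x : 0 < x -> pos_summable (fun j => (x <= p j)%R%:R : R).
Proof.
move=> x0; apply: (@pmf_dominated _ p hp _ x^-1 _ _).1; first by rewrite invr_ge0 ltW.
move=> j _; rewrite ler0n/=; case: (leP x (p j)) => xp.
  by rewrite mulrC ler_pdivlMr// mul1r.
by rewrite mulr_ge0// invr_ge0 ltW.
Qed.

Lemma counting_funE x : 0 < x -> counting_fun p x = tsum (fun j => (x <= p j)%R%:R).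
Proof.
move=> x0; have /tsum_cvg cp := pmf_summable hp.
(* The terms of a convergent series tend to 0, so only finitely many p_j reach x. *)
have [N pN] : exists N, forall j, (N <= j)%N -> p j < x.
  have : (\sum_(1 <= j < N.+1) p j - \sum_(1 <= j < N) p j) @[N --> \oo] --> (0 : R).
    rewrite -[X in _ --> X](subrr (tsum p)).
    by apply: cvgB => //; have := cp; rewrite -cvg_shiftS.
  move=> /cvgrPdist_lt/(_ x x0)[N _ NP]; exists N.+1 => j Nj.
  have := NP j (ltnW Nj); rewrite /= big_nat_recr//=; last by lia.
  by rewrite (addrC (\sum_(1 <= i < j) p i)) addrK sub0r normrN ger0_norm.
have sE : tsum (fun j => (x <= p j)%R%:R) = \sum_(1 <= j < N) (x <= p j)%R%:R :> R.
  apply: le_anti; rewrite (tsum_partial _ (count_summable x0)) andbT.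
  apply: (@tsum_le _ _ _ _ _).2 => // M.
  have [MN|NM] := leqP M N.
    have [M1|M1] := leqP M 1; first by rewrite big_geq// sumr_ge0.
    by rewrite (@big_cat_nat _ _ _ M 1 N)//= 1?ltnW// lerDl sumr_ge0.
  have [N1|N1] := leqP N 1.
    rewrite [X in _ <= X]big_geq// big_nat_cond big1// => j /andP[/andP[j1 _] _].
    by rewrite leNgt pN//; exact: leq_trans j1.
  have tail0 : \sum_(N <= j < M) (x <= p j)%R%:R = 0 :> R.
    by rewrite big_nat_cond big1// => j /andP[/andP[j1 _] _]; rewrite leNgt pN.
  by rewrite (@big_cat_nat _ _ _ N 1 M)//= 1?ltnW// tail0 addr0.
rewrite sE /counting_fun -natr_sum; congr (_%:R).
pose s := [seq j <- index_iota 1 N | x <= p j].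
have finA : finite_set [set j : nat | (1 <= j)%N /\ x <= p j].
  apply: (sub_finite_set _ (finite_II N)) => j /= [_ xp].
  by rewrite ltnNge; apply/negP => /pN; rewrite ltNge xp.
have -> : size (fset_set [set j : nat | (1 <= j)%N /\ x <= p j]) = size s.
  apply/perm_size/uniq_perm; first exact: fset_uniq.
    by rewrite filter_uniq// iota_uniq.
  move=> j; rewrite in_fset_set// mem_filter mem_index_iota.
  apply/idP/idP => [/set_mem[/= j1 xp]|/andP[xp /andP[j1 _]]]; last exact/mem_set.
  by rewrite xp j1/= ltnNge; apply/negP => /pN; rewrite ltNge xp.
rewrite size_filter -sum1_count big_mkcond/=.
by apply: eq_bigr => j _; case: (x <= p j).
Qed.

(** The value of the counting function at 1 / t, as a series; see [counting_funE]. *)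
Definition ncount (t : R) : R := tsum (fun j => (t^-1 <= p j)%R%:R).
Definition nblock (t : R) : R := tsum (fun j => (((2 * t)^-1 <= p j) && (p j < t^-1))%:R).
(** The weight is the bound (n p)^2 on P(X_j >= 2) at t = n. Doubling t multiplies it by 4, which
    must exceed the growth factor 3 allowed for [nblock]. *)
Definition light (t : R) : R := tsum (fun j => (p j < t^-1)%R%:R * (t * p j) ^+ 2).
(** The counterpart above 1 / t: the exponential decay of P(X_j = 2) is replaced by the power (n
    p)^-2, enough for a recursion of ratio 1/4. *)
Definition heavy (t : R) : R := tsum (fun j => (t^-1 <= p j)%R%:R / (t * p j) ^+ 2).

Lemma ncount_le t : 0 < t -> pos_summable (fun j => (t^-1 <= p j)%R%:R : R) /\ ncount t <= t.
Proof.
move=> t0; apply: (pmf_dominated hp (ltW t0)) => j _; rewrite ler0n/=.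
case: (leP t^-1 (p j)) => tp; last by rewrite mulr_ge0// ltW.
by rewrite mulr1n -(mulfV (lt0r_neq0 t0)) ler_pM2l.
Qed.

Lemma nblock_summable t : 0 < t ->
  pos_summable (fun j => (((2 * t)^-1 <= p j) && (p j < t^-1))%:R : R).
Proof.
move=> t0; have [|h _] := @ncount_le (2 * t); first by rewrite mulr_gt0.
apply: (le_tsum _ _ h).1 => j _ //.
by rewrite ler_nat; case: (_ <= p j); rewrite //= leq_b1.
Qed.

Lemma nblockE t : 0 < t -> nblock t = ncount (2 * t) - ncount t.
Proof.
move=> t0; apply/eqP; rewrite eq_sym subr_eq; apply/eqP.
rewrite -tsumD; [|exact: nblock_summable|exact: (ncount_le t0).1].
apply: eq_tsum => j _; rewrite -natrD; congr (_%:R).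
have : (2 * t)^-1 <= t^-1 by rewrite lef_pV2 ?posrE ?mulr_gt0//; lra.
by case: (leP t^-1 (p j)) => /= h1 h2; rewrite ?andbT ?andbF ?addn0// (le_trans h2 h1).
Qed.

Lemma light_le t : 0 < t ->
  pos_summable (fun j => (p j < t^-1)%R%:R * (t * p j) ^+ 2) /\ light t <= t.
Proof.
move=> t0; apply: (pmf_dominated hp (ltW t0)) => j _.
have tp : 0 <= t * p j by rewrite mulr_ge0// ltW.
rewrite mulr_ge0 ?exprn_ge0//=; case: (ltP (p j) t^-1) => pt; last by rewrite mulr0n mul0r.
rewrite mulr1n mul1r expr2 ler_piMl//.
by rewrite -(mulfV (lt0r_neq0 t0)) ler_pM2l// ltW.
Qed.

Lemma heavy_term t j : 0 < t -> t^-1 <= p j -> 0 <= ((t * p j) ^+ 2)^-1 <= 1.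
Proof.
move=> t0 tp; have h : 1 <= t * p j by rewrite -(mulfV (lt0r_neq0 t0)) ler_pM2l.
have h2 : 1 <= (t * p j) ^+ 2 by rewrite exprn_ege1.
by rewrite invr_ge0 exprn_ge0 ?(le_trans ler01)//= invf_le1// (lt_le_trans ltr01).
Qed.

Lemma heavy_le t : 0 < t ->
  pos_summable (fun j => (t^-1 <= p j)%R%:R / (t * p j) ^+ 2) /\ heavy t <= t.
Proof.
move=> t0; have [h1 h2] := ncount_le t0.
have [||g1 g2] := @le_tsum _ (fun j => (t^-1 <= p j)%R%:R / (t * p j) ^+ 2) _ _ _ h1.
- by move=> j _; rewrite divr_ge0// exprn_ge0// mulr_ge0// ltW.
- move=> j _; case: (leP t^-1 (p j)) => tp; last by rewrite mulr0n mul0r.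
  by rewrite mulr1n mul1r; case/andP: (heavy_term t0 tp).
by split=> //; exact: le_trans h2.
Qed.

(** A cell of the block contributes at most 1; for the smaller ones, (t p)^2 is a quarter of (2 t
    p)^2. *)
Lemma light_rec t : 0 < t -> light t <= nblock t + light (2 * t) / 4.
Proof.
move=> t0; have t20 : 0 < 2 * t by rewrite mulr_gt0.
have [s2 _] := light_le t20.
rewrite [_ / 4]mulrC -tsumZ// -tsumD; [|exact: nblock_summable|exact: pos_summableZ].
apply: (le_tsum _ _ _).2.
- by move=> j _; rewrite mulr_ge0// exprn_ge0// mulr_ge0// ltW.
- move=> j _; case: (ltP (p j) t^-1) => pt; last first.
    by rewrite mulr0n mul0r addr_ge0// !mulr_ge0 ?exprn_ge0// ?mulr_ge0// ltW.
  have tp1 : t * p j <= 1 by rewrite -(mulfV (lt0r_neq0 t0)) ler_pM2l// ltW.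
  have tp0 : 0 <= t * p j by rewrite mulr_ge0// ltW.
  rewrite mulr1n mul1r; case: (leP (2 * t)^-1 (p j)) => p2 /=.
    by rewrite mulr0n mul0r mulr0 addr0 exprn_ile1.
  by rewrite mulr0n mulr1n add0r mul1r le_eqVlt; apply/orP; left; apply/eqP; field.
by apply: pos_summableD; [exact: nblock_summable|exact: pos_summableZ].
Qed.

(** The mirror image of [light_rec]: cells that were already heavy lose a factor 4 when t
    doubles. *)
Lemma heavy_rec t : 0 < t -> heavy (2 * t) <= nblock t + heavy t / 4.
Proof.
move=> t0; have t20 : 0 < 2 * t by rewrite mulr_gt0.
have [s1 _] := heavy_le t0.
rewrite [_ / 4]mulrC -tsumZ// -tsumD; [|exact: nblock_summable|exact: pos_summableZ].
apply: (le_tsum _ _ _).2.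
- by move=> j _; rewrite divr_ge0// exprn_ge0// mulr_ge0// ltW.
- move=> j _; have tt : (2 * t)^-1 <= t^-1 by rewrite lef_pV2 ?posrE ?mulr_gt0//; lra.
  case: (leP (2 * t)^-1 (p j)) => p2; last first.
    by rewrite mulr0n mul0r addr_ge0// !mulr_ge0 ?invr_ge0 ?exprn_ge0// mulr_ge0// ltW.
  case: (ltP (p j) t^-1) => pt /=.
    rewrite !mulr1n mulr0n !mul0r mulr0 addr0 mul1r.
    by case/andP: (heavy_term t20 p2).
  rewrite mulr0n mulr1n add0r !mul1r le_eqVlt; apply/orP; left; apply/eqP.
  have pj : 0 < p j by apply: lt_le_trans pt; rewrite invr_gt0.
  by field; rewrite !gt_eqF.
by apply: pos_summableD; [exact: nblock_summable|exact: pos_summableZ].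
Qed.

(** * Light and heavy sums are of the order of one block *)

Section regular_blocks.
Variable t0 : R.
Hypothesis t0_gt0 : 0 < t0.
Hypothesis blockD : forall t, t0 <= t -> nblock (2 * t) <= 3 * nblock t.
Hypothesis blockH : forall t, t0 <= t -> nblock t <= 2 * nblock (2 * t).
Hypothesis block1 : forall t, t0 <= t -> 1 <= nblock t.

(** Iterate [light_rec] upwards: 1 + 4 * 3 / 4 = 4 reproduces the constant, and the crude bound
    light t <= t leaves after K doublings an error t / 2^K, which vanishes in the limit. *)
Lemma light_block t : t0 <= t -> light t <= 4 * nblock t.
Proof.
move=> tt; have iter K : forall t, t0 <= t -> light t <= 4 * nblock t + t / 2 ^+ K.
  elim: K => [|K IH] u uu; have u0 := lt_le_trans t0_gt0 uu.
    rewrite expr0 divr1; apply: le_trans (light_le u0).2 _.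
    by rewrite lerDr mulr_ge0// (le_trans ler01)// block1.
  apply: le_trans (light_rec u0) _.
  have := IH (2 * u) ltac:(lra); have := blockD uu.
  rewrite exprS invfM; move: (2 ^+ K)^-1 => z; lra.
rewrite leNgt; apply/negP => h.
have u0 := lt_le_trans t0_gt0 tt.
pose e := light t - 4 * nblock t; have e0 : 0 < e by rewrite subr_gt0.
pose K := (Num.truncn (t / e)).+1.
have : t / e < 2 ^+ K.
  apply: lt_trans (truncnS_gt _) _.
  by rewrite -natrX ltr_nat ltn_expl.
rewrite ltr_pdivrMr// mulrC -ltr_pdivrMr ?exprn_gt0//; apply/negP; rewrite -leNgt.
by rewrite /e lerBlDl; exact: iter.
Qed.

(** Induction on doublings from [t0, 2 t0], where heavy t <= t <= 2 t0 is enough. In the step, (1 +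
    C / 4) D(u) <= (2 + C / 2) D(2 u) <= C D(2 u) because C >= 4. *)
Lemma heavy_block : exists2 C : R, 0 < C & forall t, t0 <= t -> heavy t <= C * nblock t.
Proof.
pose C := 4 + 2 * t0; exists C; first by rewrite addr_gt0// mulr_gt0.
have base t : t0 <= t -> t <= 2 * t0 -> heavy t <= C * nblock t.
  move=> tt t2; have u0 := lt_le_trans t0_gt0 tt.
  apply: le_trans (heavy_le u0).2 _; have b1 := block1 tt.
  apply: (@le_trans _ _ (C * 1)); first by rewrite /C; lra.
  by rewrite ler_pM2l// /C; have := t0_gt0; lra.
have iter K : forall t, t0 <= t -> t <= 2 ^+ K * t0 -> heavy t <= C * nblock t.
  elim: K => [|K IH] t tt; first by rewrite expr0 mul1r => t1; apply: base => //; have := t0_gt0; lra.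
  move=> tK; have [t2|t2] := leP t (2 * t0); first exact: base.
  pose u := t / 2; have tE : t = 2 * u by rewrite /u; lra.
  have uu : t0 <= u by rewrite /u; lra.
  have u0 := lt_le_trans t0_gt0 uu.
  have := IH u uu; rewrite tE exprS in tK; have {}tK : u <= 2 ^+ K * t0 by lra.
  move=> /(_ tK) hu; rewrite tE; apply: le_trans (heavy_rec u0) _.
  have h2 : 1 <= nblock (2 * u) by apply: block1; lra.
  have h3 := blockH uu; have h0 := ltW t0_gt0.
  have h4 := ler_wpM2l h0 h3; have h5 := ler_wpM2l h0 h2.
  move: h4 h5 h2 h3 h0 hu; rewrite /C.
  move: (nblock u) (nblock (2 * u)) (heavy u) => x y z; lra.
move=> t tt; apply: (iter (Num.truncn (t / t0)).+1) => //.
rewrite -ler_pdivrMr// ltW//; apply: lt_trans (truncnS_gt _) _.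
by rewrite -natrX ltr_nat ltn_expl.
Qed.

End regular_blocks.
End counting.

(** * Mean occupancy counts in terms of blocks *)

Section means.
Context (R : realType) (p : nat -> R).
Hypothesis p01 : forall v, 0 <= p v <= 1.
Hypothesis hp : is_pmf p.

Let p0 v : 0 <= p v. Proof. by case/andP: (p01 v). Qed.
Let q0 v : 0 <= 1 - p v. Proof. by rewrite subr_ge0; case/andP: (p01 v). Qed.

Lemma expR_ge_pow4 (x : R) : 0 <= x -> x ^+ 4 <= 24 * expR x.
Proof.
move=> x0; have := expR_ge1Dxn 3 x0; rewrite (_ : (4`!%:R : R) = 24)//.
rewrite -[x in X in _ -> X <= _]mulr1 => h.
suff : x ^+ 4 / 24 <= expR x by lra.
by apply: le_trans h; rewrite lerDr.
Qed.

(** With y = n x / 2 and n - 2 >= n / 2, the left side is at most 16 y^4 e^-y <= 16 * 24. *)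
Lemma pow4_decay (x : R) (n : nat) : (4 <= n)%N -> 0 <= x <= 1 ->
  (n%:R * x) ^+ 4 * (1 - x) ^+ n.-2 <= 384.
Proof.
move=> n4 /andP[x0 x1]; have n0 : 0 <= n%:R :> R by [].
have e : (1 - x) ^+ n.-2 <= expR (- (n%:R * x / 2)).
  apply: (@le_trans _ _ (expR (- x) ^+ n.-2)).
    by apply: lerXn2r; rewrite ?nnegrE ?subr_ge0 ?expR_ge0//; have := expR_ge1Dx (- x).
  rewrite -expRM_natl ler_expR mulrN lerN2.
  have : n%:R <= 2 * n.-2%:R :> R by rewrite -natrM ler_nat; lia.
  by move=> h; have := ler_wpM2r x0 h; lra.
have y0 : 0 <= n%:R * x / 2 by rewrite divr_ge0 ?mulr_ge0.
have y4 := expR_ge_pow4 y0.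
apply: (@le_trans _ _ ((n%:R * x) ^+ 4 * expR (- (n%:R * x / 2)))).
  by rewrite ler_wpM2l ?exprn_ge0 ?mulr_ge0.
rewrite expRN ler_pdivrMr ?expR_gt0// (_ : n%:R * x = 2 * (n%:R * x / 2)); last by field.
rewrite [_ ^+ 4]exprMn; move: (n%:R * x / 2) y4 => y y4.
have -> : 2 * y / 2 = y by field.
lra.
Qed.

(** The second-moment term is at most (n p)^2 (1 - p)^(n - 2): drop the power for light cells, and
    use the bounded fourth power for heavy ones. *)
Lemma mean2_le : exists2 K : R, 0 < K & forall n, (4 <= n)%N ->
  'C(n, 2)%:R * tmom p 2 n.-2 <= light p n%:R + K * heavy p n%:R.
Proof.
have [K K0 hK] : exists2 K : R, 0 < K & forall (n : nat) (x : R), (4 <= n)%N ->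
    0 <= x <= 1 -> (n%:R * x) ^+ 4 * (1 - x) ^+ n.-2 <= K.
  by exists 384 => [|n x n4 x01]; [rewrite ltr0n|exact: pow4_decay].
exists K => // n n4; have n0 : 0 < n%:R :> R by rewrite ltr0n; lia.
have [sl _] := light_le p01 hp n0; have [sh _] := heavy_le p01 hp n0.
rewrite -tsumZ//; last exact: tmom_summable.
have sK := pos_summableZ (ltW K0) sh.
rewrite -(tsumZ (ltW K0) sh) -tsumD//.
apply: (le_tsum _ _ _).2.
- by move=> j _; rewrite !mulr_ge0// exprn_ge0.
- move=> j _; have C2 : 'C(n, 2)%:R <= n%:R ^+ 2 :> R.
    by rewrite -natrX ler_nat bin2 expnS expn1; have := leq_half_double (n * n.-1) (n * n); nia.
  apply: (@le_trans _ _ (n%:R ^+ 2 * (p j ^+ 2 * (1 - p j) ^+ n.-2))).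
    by rewrite ler_wpM2r ?mulr_ge0 ?exprn_ge0.
  rewrite mulrA -exprMn.
  case: (leP n%:R^-1 (p j)) => np; last first.
    rewrite mulr1n mulr0n mul0r mulr0 addr0 mul1r ler_piMr ?exprn_ge0 ?mulr_ge0//.
    by rewrite exprn_ile1// lerBlDr lerDl.
  rewrite mulr1n mulr0n mul0r add0r mul1r.
  have pj : 0 < p j by apply: lt_le_trans np; rewrite invr_gt0.
  have x0 : 0 < (n%:R * p j) ^+ 2 by rewrite exprn_gt0// mulr_gt0.
  rewrite ler_pdivlMr//; apply: le_trans (hK _ _ n4 (p01 j)).
  by rewrite mulrAC -exprD.
exact: pos_summableD.
Qed.

(** In the block at 2 n, n p lies between 1/4 and 1/2, so Bernoulli's inequality gives (1 - p)^(n -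
    1) >= 1/2 and each cell contributes at least 1/8. *)
Lemma mean1_ge n : (0 < n)%N -> nblock p (2 * n%:R) <= 8 * (n%:R * tmom p 1 n.-1).
Proof.
move=> n_gt0; have n0 : 0 < n%:R :> R by rewrite ltr0n.
have s1 := tmom_summable p01 hp n.-1 (ltn0Sn 0).
have C0 : 0 <= 8 * n%:R :> R by rewrite mulr_ge0// ltW.
rewrite mulrA -tsumZ//; apply: (le_tsum _ _ (pos_summableZ C0 s1)).2 => j _ //.
case: (leP (2 * (2 * n%:R))^-1 (p j)) => h1; last first.
  by rewrite mulr0n !mulr_ge0// exprn_ge0.
case: (ltP (p j) (2 * n%:R)^-1) => h2; last by rewrite mulr0n !mulr_ge0// exprn_ge0.
rewrite mulr1n expr1.
have {}h1 : 1 <= 4 * (n%:R * p j).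
  by move: h1; rewrite -[X in X <= _]mul1r ler_pdivrMr ?mulr_gt0//; lra.
have {}h2 : n%:R * p j <= 1 / 2.
  by move: h2; rewrite -[X in _ < X]mul1r ltr_pdivlMr ?mulr_gt0//; lra.
have h3 : 1 / 2 <= (1 - p j) ^+ n.-1.
  have := bmean_ge1_le n.-1 (p01 j); rewrite bmean_ge1.
  have : n.-1%:R * p j <= n%:R * p j by rewrite ler_wpM2r// ler_nat leq_pred.
  lra.
have h4 : 1 / 2 <= 2 * (n%:R * p j) by lra.
have := ler_pM _ _ h4 h3; move=> /(_ _ _)/=; lra.
Qed.

Lemma mean_ge2_le n : (0 < n)%N ->
  tsum (cell_mean p (leq 2) n) <= light p n%:R + ncount p n%:R.
Proof.
move=> n_gt0; have n0 : 0 < n%:R :> R by rewrite ltr0n.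
have [sl _] := light_le p01 hp n0; have [sc _] := ncount_le p01 hp n0.
rewrite -tsumD//; apply: (le_tsum _ _ _).2.
- by move=> j _; exact: cell_mean_ge0.
- move=> j _; case: (leP n%:R^-1 (p j)) => np.
    by rewrite mulr0n mulr1n mul0r add0r cell_mean_le1.
  by rewrite mulr1n mulr0n mul1r addr0; exact: bmean_ge2_le.
exact: pos_summableD.
Qed.

Section growth.
Variables (f : R -> R) (t0 b l : R).
Hypotheses (t0_gt0 : 0 < t0) (b_gt0 : 0 < b) (l_gt1 : 1 < l).
Hypothesis fb : forall t, t0 <= t -> b <= f t.
Hypothesis fl : forall t, t0 <= t -> l * f t <= f (2 * t).

(** A factor l > 1 per doubling means growth of order t^(log_2 l). Raising [f] to an integer power
    instead avoids a real exponent. *)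
Lemma doubling_growth : exists m : nat, exists2 c : R, 0 < c &
  forall t, t0 <= t -> c * t <= f t ^+ m.+1.
Proof.
have bern k : 1 + k%:R * (l - 1) <= l ^+ k.
  elim: k => [|k IH]; first by rewrite mul0r addr0 expr0.
  rewrite exprS -natr1; have l0 : 0 <= l by have := l_gt1; lra.
  apply: le_trans (ler_wpM2l l0 IH); have : 0 <= k%:R :> R by [].
  have : 0 <= (l - 1) * (l - 1) by rewrite -expr2 sqr_ge0.
  move=> h1 h2; have := mulr_ge0 h2 h1; lra.
(* By Bernoulli's inequality l^(m + 1) >= 2, so f^(m + 1) at least doubles when t does. *)
pose m := Num.truncn (1 / (l - 1)).
have l1 : 0 < l - 1 by rewrite subr_gt0.
have l2 : 2 <= l ^+ m.+1.
  apply: le_trans (bern _).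
  have : 1 / (l - 1) < m.+1%:R by exact: truncnS_gt.
  by rewrite ltr_pdivrMr//; lra.
exists m, (b ^+ m.+1 / (2 * t0)); first by rewrite divr_gt0 ?exprn_gt0 ?mulr_gt0.
set c := b ^+ m.+1 / (2 * t0).
have c0 : 0 < c by rewrite divr_gt0 ?exprn_gt0 ?mulr_gt0.
have cE : c * (2 * t0) = b ^+ m.+1.
  by rewrite /c mulfVK// gt_eqF// mulr_gt0.
have base t : t0 <= t -> t <= 2 * t0 -> c * t <= f t ^+ m.+1.
  move=> tt t2; apply: (@le_trans _ _ (b ^+ m.+1)); first by rewrite -cE ler_pM2l.
  by rewrite lerXn2r ?nnegrE ?(ltW b_gt0)// ?fb// (le_trans (ltW b_gt0))// fb.
have iter K : forall t, t0 <= t -> t <= 2 ^+ K * t0 -> c * t <= f t ^+ m.+1.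
  elim: K => [|K IH] t tt; first by rewrite expr0 mul1r => t1; apply: base => //; have := t0_gt0; lra.
  move=> tK; have [t2|t2] := leP t (2 * t0); first exact: base.
  pose u := t / 2; have tE : t = 2 * u by rewrite /u; lra.
  have uu : t0 <= u by rewrite /u; lra.
  have := IH u uu; rewrite tE exprS in tK; have {}tK : u <= 2 ^+ K * t0 by lra.
  move=> /(_ tK) hu; rewrite tE.
  have fu0 : 0 <= f u by rewrite (le_trans (ltW b_gt0))// fb.
  apply: (@le_trans _ _ ((l * f u) ^+ m.+1)).
    rewrite exprMn; apply: (@le_trans _ _ (2 * f u ^+ m.+1)); first by lra.
    by rewrite ler_wpM2r// exprn_ge0.
  by rewrite lerXn2r ?nnegrE ?fl// ?mulr_ge0 ?(le_trans _ l_gt1)// ?(le_trans (ltW b_gt0) (fb _))//; have := l_gt1; lra.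
move=> t tt; apply: (iter (Num.truncn (t / t0)).+1) => //.
rewrite -ler_pdivrMr// ltW//; apply: lt_trans (truncnS_gt _) _.
by rewrite -natrX ltr_nat ltn_expl.
Qed.
End growth.

Lemma sum_inv_sq_le N : \sum_(1 <= n < N.+1) (n%:R ^+ 2)^-1 <= 2 - 2 / N.+1%:R :> R.
Proof.
elim: N => [|N IH]; first by rewrite big_geq// divr1 subrr.
rewrite big_nat_recr//=; apply: le_trans (lerD IH (lexx _)) _.
rewrite -[N.+2%:R]natr1; have : 1 <= N.+1%:R :> R by rewrite ler1n.
move: N.+1%:R => x x1.
rewrite -subr_ge0 (_ : _ - _ = (x - 1) / (x ^+ 2 * (x + 1))); last first.
  by field; apply/andP; split; apply: lt0r_neq0; lra.
by rewrite divr_ge0 ?subr_ge0// mulr_ge0 ?exprn_ge0//; lra.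
Qed.

(** Keep the term of degree 2 (m + 1) of the exponential series: since a_n^(m + 1) >= c n, the
    summand is O(n^-2). The first terms are bounded by 1. *)
Lemma expR_summable (a : nat -> R) m (c : R) n1 : 0 < c ->
  (forall n, 0 <= a n) ->
  (forall n, (n1 <= n)%N -> c * n%:R <= a n ^+ m.+1) ->
  forall k, 0 < k -> (\sum_(0 <= n <oo) (expR (- k * a n))%:E < +oo)%E.
Proof.
move=> c0 a0 ca k k0; pose M := (2 * m).+1.
pose C : R := M.+1`!%:R / ((k ^+ m.+1 * c) ^+ 2).
have C0 : 0 <= C by rewrite divr_ge0 ?sqr_ge0.
have le n : (n1 <= n)%N -> (0 < n)%N -> expR (- k * a n) <= C * (n%:R ^+ 2)^-1.
  move=> nn n_gt0; have n0 : 0 < n%:R :> R by rewrite ltr0n.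
  have y0 : 0 <= k * a n by rewrite mulr_ge0// ltW.
  have h := expR_ge1Dxn M y0.
  have kc : 0 < k ^+ m.+1 * c by rewrite mulr_gt0 ?exprn_gt0.
  have yc : (k ^+ m.+1 * c * n%:R) ^+ 2 <= (k * a n) ^+ M.+1.
    have -> : M.+1 = (m.+1 * 2)%N by rewrite /M; lia.
    rewrite exprM; apply: lerXn2r; rewrite ?nnegrE.
    - by apply: mulr_ge0; exact: ltW.
    - exact: exprn_ge0.
    by rewrite exprMn -mulrA ler_wpM2l ?ca// exprn_ge0// ltW.
  have F0 : 0 < M.+1`!%:R :> R by rewrite ltr0n fact_gt0.
  have e1 : (k ^+ m.+1 * c * n%:R) ^+ 2 / M.+1`!%:R <= expR (k * a n).
    apply: (@le_trans _ _ ((k * a n) ^+ M.+1 / M.+1`!%:R)).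
      by rewrite ler_pM2r ?invr_gt0.
    by apply: le_trans h; rewrite lerDr.
  have CE : C * (n%:R ^+ 2)^-1 = ((k ^+ m.+1 * c * n%:R) ^+ 2 / M.+1`!%:R)^-1.
    by rewrite /C [in RHS]exprMn invf_div -mulrA -invfM.
  rewrite CE mulNr expRN lef_pV2// posrE ?expR_gt0// divr_gt0// exprn_gt0//.
  by rewrite mulr_gt0.
apply: (@le_lt_trans _ _ (n1.+1%:R + C * 2)%:E); last exact: ltry.
apply: lime_le.
  by apply: is_cvg_nneseries => n _ _; rewrite lee_fin expR_ge0.
apply: nearW => N; rewrite sumEFin lee_fin.
apply: (@le_trans _ _ (\sum_(0 <= n < n1.+1) 1 + \sum_(1 <= n < N.+1) C * (n%:R ^+ 2)^-1)).
  have e1 n : expR (- k * a n) <= 1.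
    by rewrite -expR0 ler_expR mulNr oppr_le0 mulr_ge0// ltW.
  have [Nn|nN] := leqP N n1.+1.
    apply: ler_wpDr.
      by apply: sumr_ge0 => i _; rewrite mulr_ge0// invr_ge0 exprn_ge0.
    rewrite [leRHS](@big_cat_nat _ _ _ N 0 n1.+1)//; apply: ler_wpDr.
      exact: sumr_ge0.
    exact: ler_sum.
  rewrite (@big_cat_nat _ _ _ n1.+1 0 N)//= 1?ltnW// lerD//; first exact: ler_sum.
  apply: (@le_trans _ _ (\sum_(n1.+1 <= n < N) C * (n%:R ^+ 2)^-1)).
    by apply: ler_sum_nat => n /andP[n1n _]; apply: le; lia.
  rewrite [leRHS](@big_cat_nat _ _ _ n1.+1 1 N.+1)//=; last by lia.
  rewrite [X in _ <= _ + X](@big_cat_nat _ _ _ N n1.+1 N.+1)//=; last by lia.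
  rewrite addrCA lerDl addr_ge0// sumr_ge0// => i _; rewrite mulr_ge0// invr_ge0 exprn_ge0//.
rewrite sumr_const_nat subn0 lerD2l// -mulr_sumr ler_wpM2l//.
by apply: le_trans (sum_inv_sq_le N) _; rewrite lerBlDr lerDl divr_ge0.
Qed.
End means.

(** * Regular variation *)

Lemma near_pinfty_ge (R : realType) (Q : R -> Prop) : (\forall t \near +oo, Q t) ->
  exists2 t0 : R, 0 < t0 & forall t, t0 <= t -> Q t.
Proof.
move=> [M [_ MQ]]; exists (Num.max 1 (M + 1)); first by rewrite lt_max ltr01.
by move=> t; rewrite ge_max => /andP[_ Mt]; apply: MQ; apply: lt_le_trans Mt; rewrite ltrDl.
Qed.

Lemma cvg_double (R : realType) : (2 * t : R) @[t --> +oo] --> +oo.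
Proof.
apply/cvgryPge => B; near=> t.
have : 0 <= t by near: t; apply: nbhs_pinfty_ge; exact: num_real.
have : B <= t by near: t; apply: nbhs_pinfty_ge; exact: num_real.
lra.
Unshelve. all: by end_near. Qed.

Lemma near_double (R : realType) (Q : R -> Prop) :
  (\forall t \near +oo, Q t) -> \forall t \near +oo, Q (2 * t).
Proof. by move=> h; exact: (@cvg_double R _ h). Qed.

Lemma cvg_at_double (R : realType) (h : R -> R) (y : R) :
  h t @[t --> +oo] --> y -> h (2 * t) @[t --> +oo] --> y.
Proof. by move=> hy; apply: (@cvg_comp _ _ _ (fun t => 2 * t) h _ _ _ (@cvg_double R) hy). Qed.

Section special.
Context (R : realType) (p : nat -> R).
Hypothesis p01 : forall v, 0 <= p v <= 1.
Hypothesis hp : is_pmf p.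

Local Notation D := (nblock p).
Local Notation N := (ncount p).

Lemma ncountE t : 0 < t -> counting_fun p (1 / t) = N t.
Proof. by move=> t0; rewrite div1r counting_funE ?invr_gt0. Qed.

Lemma ncount_mono s t : 0 < s -> s <= t -> N s <= N t.
Proof.
move=> s0 st; have t0 := lt_le_trans s0 st.
apply: (le_tsum _ _ (ncount_le p01 hp t0).1).2 => j _ //.
rewrite ler_nat; case: (leP s^-1 (p j)) => // sp.
by rewrite (le_trans _ sp)// lef_pV2.
Qed.

Definition regular_blocks (t0 : R) := [/\ 0 < t0,
  forall t, t0 <= t -> D (2 * t) <= 3 * D t,
  forall t, t0 <= t -> D t <= 2 * D (2 * t) &
  forall t, t0 <= t -> 1 <= D t].

Lemma regular_blocks_mean t0 : regular_blocks t0 ->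
  (exists C, \forall n \near \oo,
    'C(n, 2)%:R * tmom p 2 n.-2 <= C * (n%:R * tmom p 1 n.-1)) /\
  \forall n \near \oo, D n%:R <= 16 * (n%:R * tmom p 1 n.-1).
Proof.
move=> [t0_gt0 bD bH b1].
have lower n : (0 < n)%N -> t0 <= n%:R -> D n%:R <= 16 * (n%:R * tmom p 1 n.-1).
  move=> n0 tn; apply: le_trans (bH _ tn) _.
  by have := mean1_ge p01 hp n0; lra.
split; last first.
  near=> n; apply: lower; near: n; [exact: nbhs_infty_gt|exact: nbhs_infty_ger].
have [K K0 hK] := mean2_le p01 hp.
have [C C0 hC] := heavy_block p01 hp t0_gt0 bH b1.
have KC0 : 0 <= K * C by rewrite mulr_ge0// ltW.
exists ((4 + K * C) * 16); near=> n.
have n4 : (4 <= n)%N by near: n; exact: nbhs_infty_ge.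
have tn : t0 <= n%:R by near: n; exact: nbhs_infty_ger.
apply: le_trans (hK _ n4) _.
have h1 := light_block p01 hp t0_gt0 bD b1 tn.
have h2 := ler_wpM2l (ltW K0) (hC _ tn).
apply: (@le_trans _ _ ((4 + K * C) * D n%:R)); first by lra.
by rewrite -mulrA ler_wpM2l ?addr_ge0// lower//; exact: leq_trans n4.
Unshelve. all: by end_near. Qed.

Section regularly_varying.
Variable alpha : R.
Hypothesis alpha01 : 0 < alpha <= 1.
Hypothesis rv : regularly_varying (counting_fun p) alpha.

Let r : R := 2 `^ alpha.

Let r_gt1 : 1 < r.
Proof.
have /andP[a0 _] := alpha01.
have : 1 `^ alpha < r by apply: gt0_ltr_powR; rewrite ?nnegrE// ltr1n.
by rewrite powR1.
Qed.

Let r_le2 : r <= 2.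
Proof.
have /andP[_ a1] := alpha01.
by rewrite -[X in _ <= X](@powRr1 _ 2)//; apply: ler_powR; rewrite ?ler1n.
Qed.

(** With g(t) = N(t) / (t^alpha l(t)) tending to 1, the ratio equals (g(2 t) / g(t)) 2^alpha l(2 t)
    / l(t). *)
Lemma ncount_ratio : N (2 * t) / N t @[t --> +oo] --> r /\ \forall t \near +oo, 0 < N t.
Proof.
have [l sl hg] := rv.
pose g x := counting_fun p (1 / x) / (x `^ alpha * l x).
have gpos : \forall t \near +oo, 0 < g t by apply: (cvgr_gt 1 hg).
have N0 t : 0 <= N t by apply: tsum_ge0.
split; last first.
  near=> t; rewrite lt_neqAle N0 andbT; apply/negP => /eqP Nt.
  have : 0 < g t by near: t.
  rewrite /g ncountE; last by near: t; apply: nbhs_pinfty_gt; exact: num_real.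
  by rewrite -Nt mul0r ltxx.
have g2 : g (2 * t) @[t --> +oo] --> (1 : R) by exact: cvg_at_double hg.
have l2 := sl 2 ltac:(lra).
have : g (2 * t) * (g t)^-1 * (r * (l (t * 2) / l t)) @[t --> +oo] --> 1 * 1^-1 * (r * 1).
  apply: cvgM; first by apply: cvgM => //; exact: (cvgV (oner_neq0 R) hg).
  by apply: cvgM => //; exact: cvg_cst.
rewrite invr1 !mulr1 mul1r; apply: cvg_trans; apply: near_eq_cvg.
near=> t.
have t0 : 0 < t by near: t; apply: nbhs_pinfty_gt; exact: num_real.
have gt : 0 < g t by near: t.
have gt2 : 0 < g (2 * t) by near: t; apply: (near_double gpos).
have t20 : 0 < 2 * t by rewrite mulr_gt0.
(* Division by 0 yields 0, so a positive quotient has a nonzero denominator. *)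
have den s : 0 < g s -> s `^ alpha * l s != 0.
  by apply: contraTneq => e; rewrite /g e invr0 mulr0 ltxx.
have gE s : 0 < s -> 0 < g s -> N s = g s * (s `^ alpha * l s).
  by move=> s0 gs; rewrite /g ncountE// mulfVK ?den.
rewrite (gE t)// (gE (2 * t))//.
have := den _ gt; have := den _ gt2; rewrite powRM ?(ltW t0)//.
rewrite (mulrC t 2) -/r !mulf_eq0 !negb_or => /andP[_ lt2] /andP[pt lt].
rewrite -/(g t) -/(g (2 * t)).
move: (g t) (g (2 * t)) gt gt2 => x y x0 y0.
by field; rewrite pt lt gt_eqF.
Unshelve. all: by end_near. Qed.

(** D(t) / N(t) tends to r - 1 and D(2 t) / N(t) to r (r - 1), with 1 < r <= 2. Thus D(2 t) / D(t)
    tends to r, strictly between 1/2 and 3, while D is of the order of N, which grows at least like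
    a power of t. *)
Lemma regularly_varying_blocks : exists2 t0, regular_blocks t0 &
  [/\ D t @[t --> +oo] --> +oo,
   exists2 c, 0 < c & forall t, t0 <= t -> c * N t <= D t &
   exists m, exists2 c, 0 < c & forall t, t0 <= t -> c * t <= N t ^+ m.+1].
Proof.
have [rho Npos] := ncount_ratio.
have rho2 : N (2 * (2 * t)) / N (2 * t) @[t --> +oo] --> r.
  exact: (@cvg_at_double R (fun t => N (2 * t) / N t)).
(* The limit is (3 - r) (r - 1); the one in [h2] is (2 r - 1) (r - 1). *)
have h1 : \forall t \near +oo, 0 < 3 * (N (2 * t) / N t - 1) -
    N (2 * t) / N t * (N (2 * (2 * t)) / N (2 * t) - 1).
  apply: (cvgr_gt (3 * (r - 1) - r * (r - 1))).
    apply: cvgB; first by apply: cvgMr; apply: cvgB => //; exact: cvg_cst.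
    by apply: cvgM => //; apply: cvgB => //; exact: cvg_cst.
  by have := r_gt1; have := r_le2; nra.
have h2 : \forall t \near +oo, 0 < 2 * (N (2 * t) / N t * (N (2 * (2 * t)) / N (2 * t) - 1))
    - (N (2 * t) / N t - 1).
  apply: (cvgr_gt (2 * (r * (r - 1)) - (r - 1))).
    apply: cvgB; last by apply: cvgB => //; exact: cvg_cst.
    by apply: cvgMr; apply: cvgM => //; apply: cvgB => //; exact: cvg_cst.
  by have := r_gt1; have := r_le2; nra.
pose c := (r - 1) / 2; have c0 : 0 < c by rewrite divr_gt0// subr_gt0.
have h3 : \forall t \near +oo, 1 + c < N (2 * t) / N t.
  by apply: (cvgr_gt r) => //; rewrite /c; have := r_gt1; lra.
have good : \forall t \near +oo, [/\ 0 < t, 0 < N t, D (2 * t) <= 3 * D t,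
    D t <= 2 * D (2 * t) & c * N t <= D t].
  near=> t.
  have t0 : 0 < t by near: t; apply: nbhs_pinfty_gt; exact: num_real.
  have t20 : 0 < 2 * t by rewrite mulr_gt0.
  have Nt : 0 < N t by near: t.
  have N2t : 0 < N (2 * t) by near: t; exact: (near_double Npos).
  have k1 : 0 < 3 * (N (2 * t) / N t - 1) -
    N (2 * t) / N t * (N (2 * (2 * t)) / N (2 * t) - 1) by near: t.
  have k2 : 0 < 2 * (N (2 * t) / N t * (N (2 * (2 * t)) / N (2 * t) - 1))
    - (N (2 * t) / N t - 1) by near: t.
  have k3 : 1 + c < N (2 * t) / N t by near: t.
  have E1 : D t = (N (2 * t) / N t - 1) * N t.
    by rewrite nblockE// mulrBl mulfVK ?gt_eqF// mul1r.
  have E2 : D (2 * t) = N (2 * t) / N t * (N (2 * (2 * t)) / N (2 * t) - 1) * N t.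
    by rewrite nblockE//; field; rewrite !gt_eqF.
  rewrite E1 E2; split=> //.
  - by rewrite [leRHS]mulrA ler_pM2r//; lra.
  - by rewrite [leRHS]mulrA ler_pM2r//; lra.
  - by rewrite ler_pM2r//; lra.
have [t1 t1_gt0 ht1] := near_pinfty_ge good.
have Nt1 : 0 < N t1 by have [] := ht1 _ (lexx t1).
have [m [c1 c10 hc1]] : exists m : nat, exists2 c : R, 0 < c &
    forall t, t1 <= t -> c * t <= N t ^+ m.+1.
  apply: (@doubling_growth _ N t1 (N t1) (1 + c)) => //.
  - by rewrite ltrDl.
  - by move=> t tt; exact: ncount_mono.
  - move=> t tt; have [t0 Nt _ _ cD] := ht1 _ tt.
    by move: cD; rewrite nblockE//; lra.
have Doo : D t @[t --> +oo] --> +oo.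
  apply/cvgryPge => B; near=> t.
  have tt : t1 <= t by near: t; apply: nbhs_pinfty_ge; exact: num_real.
  have bt : c1^-1 * (c^-1 * B) ^+ m.+1 <= t by near: t; apply: nbhs_pinfty_ge; exact: num_real.
  have [t0 Nt _ _ cD] := ht1 _ tt.
  apply: le_trans cD; rewrite -ler_pdivrMl//.
  have [B0|B0] := leP B 0.
    by apply: le_trans (ltW Nt); rewrite mulr_ge0_le0// invr_ge0 ltW.
  have cB : 0 <= c^-1 * B by rewrite mulr_ge0 ?(ltW B0)// invr_ge0 ltW.
  rewrite -(@ler_pXn2r _ m.+1) ?nnegrE ?(ltW Nt)//.
  by apply: le_trans (hc1 _ tt); rewrite -ler_pdivrMl.
have [t2 t2_gt0 ht2] : exists2 t0 : R, 0 < t0 & forall t, t0 <= t -> 1 <= D t.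
  by apply: near_pinfty_ge; move/cvgryPge: Doo; exact.
have t12 : 0 < Num.max t1 t2 by rewrite lt_max t1_gt0.
exists (Num.max t1 t2).
  split=> // t; rewrite ge_max => /andP[tt tt2].
  - by have [] := ht1 _ tt.
  - by have [] := ht1 _ tt.
  - exact: ht2.
split=> //.
  by exists c => // t; rewrite ge_max => /andP[tt _]; have [] := ht1 _ tt.
by exists m, c1 => // t; rewrite ge_max => /andP[tt _]; exact: hc1.
Unshelve. all: by end_near. Qed.
End regularly_varying.

(** At x = 2 the de Haan limit gives D(t) ~ a(t) ln 2; the difference of the limits at 4 and 2 gives
    D(2 t) ~ a(t) ln 2 as well. So the ratio of blocks tends to 1, and D diverges with [a]. *)
Lemma de_Haan_blocks (a : R -> R) :
  de_Haan_class a (fun x => counting_fun p (1 / x)) -> a x @[x --> +oo] --> +oo ->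
  exists2 t0, regular_blocks t0 & D t @[t --> +oo] --> +oo.
Proof.
move=> [_ _ _ la] aoo.
have ln2 : 0 < ln 2 :> R by rewrite ln_gt0// ltr1n.
have ln4 : ln 4 = ln 2 + ln 2 :> R by rewrite -lnM ?posrE//; congr ln; ring.
have apos : \forall t \near +oo, 0 < a t by move/cvgryPgt: aoo; exact.
have k1 : D t / a t @[t --> +oo] --> ln 2.
  have := la 2 ltac:(lra); apply: cvg_trans; apply: near_eq_cvg; near=> t.
  have t0 : 0 < t by near: t; apply: nbhs_pinfty_gt; exact: num_real.
  by rewrite !ncountE ?mulr_gt0// [t * 2]mulrC -nblockE.
have k2 : D (2 * t) / a t @[t --> +oo] --> ln 2.
  have : (counting_fun p (1 / (t * 4)) - counting_fun p (1 / t)) / a t - D t / a t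
      @[t --> +oo] --> ln 4 - ln 2.
    by apply: cvgB => //; exact: la.
  rewrite ln4 addrK; apply: cvg_trans; apply: near_eq_cvg; near=> t.
  have t0 : 0 < t by near: t; apply: nbhs_pinfty_gt; exact: num_real.
  have t20 : 0 < 2 * t by rewrite mulr_gt0.
  have t4 : t * 4 = 2 * (2 * t) by ring.
  rewrite !ncountE ?mulr_gt0// t4 !nblockE// -mulrBl; congr (_ / _).
  by rewrite opprB addrA subrK.
have good : \forall t \near +oo, [/\ D (2 * t) <= 3 * D t & D t <= 2 * D (2 * t)].
  have h1 : \forall t \near +oo, 0 < 3 * (D t / a t) - D (2 * t) / a t.
    apply: (cvgr_gt (3 * ln 2 - ln 2)); last by lra.
    by apply: cvgB => //; exact: cvgMr.
  have h2 : \forall t \near +oo, 0 < 2 * (D (2 * t) / a t) - D t / a t.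
    apply: (cvgr_gt (2 * ln 2 - ln 2)); last by lra.
    by apply: cvgB => //; exact: cvgMr.
  near=> t.
  have at0 : 0 < a t by near: t.
  have : 0 < 3 * (D t / a t) - D (2 * t) / a t by near: t.
  have : 0 < 2 * (D (2 * t) / a t) - D t / a t by near: t.
  rewrite !mulrA -!mulrBl !pmulr_lgt0 ?invr_gt0//; lra.
have Doo : D t @[t --> +oo] --> +oo.
  have h3 : \forall t \near +oo, ln 2 / 2 < D t / a t by apply: (cvgr_gt (ln 2)) => //; lra.
  apply/cvgryPge => B; near=> t.
  have at0 : 0 < a t by near: t.
  have : ln 2 / 2 < D t / a t by near: t.
  rewrite ltr_pdivlMr// => /ltW; apply: le_trans.
  rewrite -ler_pdivrMl ?divr_gt0//; near: t.
  by move/cvgryPge: aoo; exact.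
have [t0 t0_gt0 ht0] : exists2 t0 : R, 0 < t0 & forall t, t0 <= t ->
    [/\ D (2 * t) <= 3 * D t, D t <= 2 * D (2 * t) & 1 <= D t].
  apply: near_pinfty_ge; near=> t.
  have [] : [/\ D (2 * t) <= 3 * D t & D t <= 2 * D (2 * t)] by near: t.
  by split=> //; near: t; move/cvgryPge: Doo; exact.
by exists t0 => //; split=> // t tt; have [] := ht0 _ tt.
Unshelve. all: by end_near. Qed.
End special.

(** * Convergence of the ratios *)

Section convergence.
Context d (T : measurableType d) (R : realType) (P : probability T R).
Implicit Types (Y W V : nat -> T -> R).

Lemma cvg_in_probabilityP Y (l : R) :
  (forall eps eta, 0 < eps -> 0 < eta ->
     \forall n \near \oo, (P [set w | (eps < `|Y n w - l|)%R] <= eta%:E)%E) ->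
  (forall eps n, measurable [set w | eps < `|Y n w - l|]) ->
  cvg_in_probability P Y l.
Proof.
move=> h mY eps e0; apply/fine_cvgP; split.
  by apply: nearW => n; rewrite fin_num_measure.
apply/cvgrPdist_le => eta eta0; near=> n.
rewrite sub0r normrN ger0_norm ?fine_ge0//.
rewrite -lee_fin fineK ?fin_num_measure//.
by near: n; exact: h.
Unshelve. all: by end_near. Qed.

Lemma cvg_in_probability_le Y (l : R) : cvg_in_probability P Y l ->
  (forall eps n, measurable [set w | eps < `|Y n w - l|]) ->
  forall eps eta, 0 < eps -> 0 < eta ->
     \forall n \near \oo, (P [set w | (eps < `|Y n w - l|)%R] <= eta%:E)%E.
Proof.
move=> h mY eps eta e0 eta0; have /fine_cvgP[_ /cvgrPdist_le/(_ _ eta0)] := h _ e0.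
apply: filterS => n /=; rewrite sub0r normrN ger0_norm ?fine_ge0//.
by rewrite -lee_fin fineK ?fin_num_measure.
Qed.

Lemma ratio_near1 (y r w eps : R) : 0 < eps ->
  let del := Num.min (1 / 4) (eps / 8) in
  `|y - 1| <= del -> `|r - 1| <= del -> `|w - 1| <= del -> `|y * r / w - 1| <= eps.
Proof.
move=> e0 del; have d4 : del <= 1 / 4 by rewrite /del ge_min lexx.
have d8 : del <= eps / 8 by rewrite /del ge_min lexx orbT.
have d0 : 0 < del by rewrite lt_min !divr_gt0.
rewrite !ler_norml => /andP[y1 y2] /andP[r1 r2] /andP[w1 w2].
have w0 : 0 < w by lra.
have -> : y * r / w - 1 = (y * r - w) / w by field; rewrite gt_eqF.
rewrite ler_pdivrMr// ler_pdivlMr//.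
have E : y * r - w = (y - 1) * r + (r - 1) - (w - 1) by ring.
have r0 : 0 <= r by lra.
have r54 : r <= 5 / 4 by lra.
have h1 := ler_wpM2r r0 y1; have h2 := ler_wpM2r r0 y2.
have h4 := ler_wpM2l (ltW d0) r54.
have h3 : eps * (3 / 4) <= eps * w by rewrite ler_pM2l//; lra.
rewrite E; lra.
Qed.

Lemma cvg_in_probability_ratio Y W V (r : nat -> R) :
  cvg_in_probability P Y 1 -> cvg_in_probability P W 1 -> r n @[n --> \oo] --> (1 : R) ->
  (forall eps n, measurable [set w | eps < `|Y n w - 1|]) ->
  (forall eps n, measurable [set w | eps < `|W n w - 1|]) ->
  (forall eps n, measurable [set w | eps < `|V n w - 1|]) ->
  (\forall n \near \oo, forall w, V n w = Y n w * r n / W n w) ->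
  cvg_in_probability P V 1.
Proof.
move=> hY hW hr mY mW mV VE; apply: cvg_in_probabilityP => // eps eta e0 eta0.
pose del := Num.min (1 / 4) (eps / 8).
have d0 : 0 < del by rewrite lt_min !divr_gt0.
have eta20 : 0 < eta / 2 by rewrite divr_gt0.
have nY := cvg_in_probability_le hY mY d0 eta20.
have nW := cvg_in_probability_le hW mW d0 eta20.
have nr : \forall n \near \oo, `|r n - 1| <= del.
  by move/cvgrPdist_le : hr => /(_ _ d0); apply: filterS => n; rewrite distrC.
near=> n.
have En : forall w, V n w = Y n w * r n / W n w by near: n.
have rn : `|r n - 1| <= del by near: n.
apply: (@le_trans _ _ (P ([set w | (del < `|Y n w - 1|)%R] `|` [set w | (del < `|W n w - 1|)%R]))).
  apply: le_measure; rewrite ?inE//; first exact: measurableU.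
  move=> w /= Vw; apply/orP; rewrite -[_ || _]negbK negb_or -!leNgt; apply/negP => /andP[h1 h2].
  by move: Vw; rewrite En; apply/negP; rewrite -leNgt; exact: ratio_near1.
apply: le_trans (measureU2 _ _ _) _ => //.
rewrite [eta]splitr EFinD; apply: leeD; near: n; [exact: nY|exact: nW].
Unshelve. all: by end_near. Qed.

Lemma cvg_almost_surely_ratio Y W V (r : nat -> R) :
  cvg_almost_surely P Y 1 -> cvg_almost_surely P W 1 -> r n @[n --> \oo] --> (1 : R) ->
  (\forall n \near \oo, forall w, V n w = Y n w * r n / W n w) ->
  cvg_almost_surely P V 1.
Proof.
move=> hY hW hr VE; apply: filterS2 hY hW => w Yw Ww.
have : Y n w * r n * (W n w)^-1 @[n --> \oo] --> (1 * 1 * 1^-1 : R).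
  by apply: cvgM; [exact: cvgM|exact: (cvgV (oner_neq0 R) Ww)].
rewrite invr1 !mulr1; apply: cvg_trans; apply: near_eq_cvg.
by apply: filterS VE => n ->.
Qed.

(** Borel-Cantelli for each eps = 1 / (k + 1), then a countable intersection of almost sure
    events. *)
Lemma cvg_almost_surely_expR Y (l : R) (a : nat -> R) :
  (forall eps n, measurable [set w | eps < `|Y n w - l|]) ->
  (forall c, 0 < c -> (\sum_(0 <= n <oo) (expR (- c * a n))%:E < +oo)%E) ->
  (forall eps, 0 < eps -> exists K c, [/\ 0 <= K, 0 < c &
     \forall n \near \oo,
       (P [set w | (eps < `|Y n w - l|)%R] <= (K * expR (- c * a n))%:E)%E]) ->
  cvg_almost_surely P Y l.
Proof.
move=> mY sa h.
have step k : {ae P, forall w, \forall n \near \oo, `|Y n w - l| <= k.+1%:R^-1}.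
  have k0 : 0 < k.+1%:R^-1 :> R by rewrite invr_gt0.
  have [K [c [K0 c0 [n0 _ hn]]]] := h _ k0.
  (* The tail bound holds only from [n0] on; the earlier events are emptied, which leaves the limsup
     unchanged. *)
  pose F n := if (n < n0)%N then set0 else [set w | (k.+1%:R^-1 < `|Y n w - l|)%R].
  have mF n : measurable (F n) by rewrite /F; case: ifP.
  have F0 : P (lim_sup_set F) = 0.
    apply: lim_sup_set_cvg0 => //.
    apply: (@le_lt_trans _ _ (\sum_(0 <= n <oo) (K%:E * (expR (- c * a n))%:E))%E).
      apply: lee_nneseries => [n _ _|n _]; first exact: measure_ge0.
      rewrite /F; case: ifPn => [_|]; last by rewrite -leqNgt => /hn.
      by rewrite measure0 -EFinM lee_fin mulr_ge0 ?expR_ge0.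
    rewrite nneseriesZl; last by move=> n _; rewrite lee_fin expR_ge0.
    by apply: lte_mul_pinfty => //; exact: sa.
  exists (lim_sup_set F); split=> //.
    apply: bigcap_measurable => [|n _]; first by exists 0%N.
    by apply: bigcup_measurable => j _.
  move=> w /= nw n _; apply: contrapT => nF; apply: nw.
  exists (maxn n n0) => // j /=; rewrite geq_max => /andP[nj n0j].
  rewrite leNgt; apply/negP => Yj; apply: nF; exists j => //.
  by rewrite /F ltnNge n0j.
have := ae_foralln step; apply: filterS => w hw.
apply/cvgrPdist_le => eps e0.
have ke : (Num.truncn eps^-1).+1%:R^-1 <= eps.
  by rewrite -[leRHS]invrK lef_pV2 ?posrE ?invr_gt0// ltW// truncnS_gt.
by apply: filterS (hw (Num.truncn eps^-1)) => n; rewrite distrC => /le_trans; exact.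
Qed.
End convergence.

(** * Convergence of the missing mass and of the Good-Turing ratio *)

Section consequences.
Context d (T : measurableType d) (R : realType) (P : probability T R).
Context (p : nat -> R) (U : nat -> {RV P >-> nat}).
Hypothesis p01 : forall v, 0 <= p v <= 1.
Hypothesis hp : is_pmf p.
Hypothesis hU : iid_sample p U.

Local Notation EK n r := (mean P (occ_count U n r)).
Local Notation EKge n r := (mean P (occ_count_ge U n r)).
Local Notation m1 := (tmom p 1).
Local Notation m2 := (tmom p 2).
Local Notation M := (missing_mass p U).
Local Notation G := (good_turing U).

Lemma deviation_set (X : T -> R) (m eps : R) : 0 < m ->
  [set w | eps < `|X w / m - 1|] = [set w | eps * m < `|X w - m|].
Proof.
move=> m0; have E w : `|X w / m - 1| = `|X w - m| / m.
  have -> : X w / m - 1 = (X w - m) / m by rewrite mulrBl mulfV// gt_eqF.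
  by rewrite normrM normfV (gtr0_norm m0).
by apply/seteqP; split=> w /=; rewrite E ltr_pdivlMr.
Qed.

Lemma measurable_M eps n : measurable [set w | eps < `|M n w / mean P (M n) - 1|].
Proof.
exact: (measurable_occ_set U (fun h => eps <
  `|fine (\sum_(1 <= j <oo) (p j * (h j == 0%N)%:R)%:E)%E / mean P (M n) - 1|) n).
Qed.

Lemma measurable_K eps n : measurable [set w | eps < `|occ_count U n 1 w / EK n 1 - 1|].
Proof.
exact: (measurable_occ_set U (fun h => eps <
  `|fine (\sum_(1 <= j <oo) ((h j == 1%N)%:R)%:E)%E / EK n 1 - 1|) n).
Qed.

Lemma measurable_GM eps n : measurable [set w | eps < `|G n w / M n w - 1|].
Proof.
exact: (measurable_occ_set U (fun h => eps <
  `|fine (\sum_(1 <= j <oo) ((h j == 1%N)%:R)%:E)%E / n%:R /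
    fine (\sum_(1 <= j <oo) (p j * (h j == 0%N)%:R)%:E)%E - 1|) n).
Qed.

Hypothesis bounded2 : remains_bounded (fun n => EK n 2 / EK n 1).
Hypothesis EKoo : EK n 1 @[n --> \oo] --> +oo.

(** E M_n is nonincreasing in n, and positive at arbitrarily large n because EK_1 diverges. *)
Lemma m1_gt0 n : 0 < m1 n.
Proof.
have /cvgryPgt/(_ 0)[n0 _ h] := EKoo.
have := h (n0 + n.+1)%N (leq_addr _ _); rewrite /= (mean_K1 p01 hp hU) addnS/=.
rewrite pmulr_rgt0 ?ltr0n// => /lt_le_trans; apply.
by apply: tmom_anti => //; rewrite leq_addl.
Qed.

Lemma EK1_gt0 n : (0 < n)%N -> 0 < EK n 1.
Proof. by move=> n0; rewrite (mean_K1 p01 hp hU) mulr_gt0 ?m1_gt0// ltr0n. Qed.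

Lemma second_moment_bound : exists A n0, 0 < A /\
  forall n, (n0 <= n)%N -> n.+1%:R * m2 n <= A * m1 n.+1.
Proof.
have [C [n0 _ hC]] := bounded2.
have C0 : 0 <= C by apply: le_trans (hC n0 (leqnn _)).
(* The bound at sample size n + 2 reads (n + 1) m2(n) <= 2 C m1(n + 1), because 2 'C(n + 2, 2) = (n
   + 2) (n + 1); the summand 1 makes the constant positive. *)
exists (2 * C + 1), n0; split; first by rewrite ltr_wpDl// mulr_ge0.
move=> n nn; have := hC n.+2 (leq_trans nn (leq_trans (leqnSn _) (leqnSn _))).
rewrite /= (mean_K1 p01 hp hU) (mean_K2 p01 hp hU) /=.
have K0 : 0 < n.+2%:R * m1 n.+1 by rewrite mulr_gt0 ?m1_gt0// ltr0n.
rewrite normrM normfV (gtr0_norm K0) ler_pdivrMr// => h.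
have {}h := le_trans (ler_norm _) h.
have CE : 'C(n.+2, 2)%:R * 2 = n.+2%:R * n.+1%:R :> R.
  by rewrite -!natrM mulnC -mul_bin_diag bin1.
have n20 : 0 < n.+2%:R :> R by rewrite ltr0n.
rewrite -(ler_pM2l n20) mulrA -CE.
have : 0 <= n.+2%:R * m1 n.+1 by exact: ltW.
lra.
Qed.

Lemma mean_missing_gt0 n : 0 < mean P (M n).
Proof. by rewrite (mean_missing p01 hp hU) m1_gt0. Qed.

Lemma missing_deviation eps : 0 < eps -> exists2 c : R, 0 < c &
  \forall n \near \oo, (P [set w | (eps < `|M n w / mean P (M n) - 1|)%R] <=
    (2 * expR (- c * EK n.+1 1))%:E)%E.
Proof.
move=> e0; have [A [n0 [A0 hA]]] := second_moment_bound.
have [c c0 hc] := missing_conc p01 hp A0 hA hU e0.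
exists c => //; apply: filterS hc => n.
rewrite (deviation_set _ _ (mean_missing_gt0 n)) (mean_missing p01 hp hU).
by rewrite (mean_K1 p01 hp hU).
Qed.

Lemma near_expR_EK c eta : 0 < c -> 0 < eta ->
  \forall n \near \oo, expR (- c * EK n 1) <= eta.
Proof.
move=> c0 eta0; have /cvgryPge/(_ (- ln eta / c)) := EKoo.
apply: filterS => n; rewrite ler_pdivrMr// => h.
by rewrite -[leRHS]lnK ?posrE// ler_expR; lra.
Qed.

Lemma missing_cvg_in_probability :
  cvg_in_probability P (fun n w => M n w / mean P (M n)) 1.
Proof.
apply: cvg_in_probabilityP; last exact: measurable_M.
move=> eps eta e0 eta0; have [c c0 hc] := missing_deviation e0.
have eta20 : 0 < eta / 2 by rewrite divr_gt0.
near=> n; apply: le_trans (_ : _ <= (2 * expR (- c * EK n.+1 1))%:E)%E _.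
  by near: n; exact: hc.
rewrite lee_fin; suff : expR (- c * EK n.+1 1) <= eta / 2 by lra.
near: n; have [N _ hN] := near_expR_EK c0 eta20.
by exists N => // k /= Nk; exact: (hN k.+1 (leq_trans Nk (leqnSn k))).
Unshelve. all: by end_near. Qed.

Lemma count1_cvg_in_probability :
  cvg_in_probability P (fun n w => occ_count U n 1 w / EK n 1) 1.
Proof.
apply: cvg_in_probabilityP; last exact: measurable_K.
move=> eps eta e0 eta0; have [A [n0 [A0 hA]]] := second_moment_bound.
have eta20 : 0 < eta / 2 by rewrite divr_gt0.
have [c c0 hc] := count1_conc_weak p01 hp A0 hA hU e0 eta20.
have eta80 : 0 < eta / 8 by rewrite divr_gt0.
have hE := near_expR_EK c0 eta80.
near=> n.
have K0 : 0 < EK n 1 by apply: EK1_gt0; near: n; exact: nbhs_infty_gt.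
rewrite (deviation_set _ _ K0).
have h : 0 < EK n 1 -> (P [set w | (eps * EK n 1 < `|occ_count U n 1 w - EK n 1|)%R] <=
   (4 * expR (- c * EK n 1) + eta / 2)%:E)%E by near: n; exact: hc.
apply: le_trans (h K0) _; rewrite lee_fin.
suff : expR (- c * EK n 1) <= eta / 8 by lra.
by near: n.
Unshelve. all: by end_near. Qed.

(** This is the ratio of E G_n = E M_(n-1) to E M_n, which exceeds 1 by at most A / n. *)
Lemma mean_ratio_cvg : m1 n.-1 / m1 n @[n --> \oo] --> (1 : R).
Proof.
have [A [n0 [A0 hA]]] := second_moment_bound.
apply/cvgrPdist_le => eps e0; near=> n.
have nn : (n0 < n)%N by near: n; exact: nbhs_infty_gt.
have n_gt0 : 0 < n%:R :> R by rewrite ltr0n; exact: leq_ltn_trans nn.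
have := m1_pred_le p01 hp hA nn; move=> /andP[h1 h2].
have An : A / eps <= n%:R by near: n; exact: nbhs_infty_ger.
rewrite distrC ger0_norm; last by rewrite subr_ge0 ler_pdivlMr ?m1_gt0// mul1r.
rewrite lerBlDr ler_pdivrMr ?m1_gt0//; apply: le_trans h2 _.
rewrite ler_wpM2r ?tmom_ge0// addrC lerD2r ler_pdivrMr//.
by rewrite -ler_pdivrMl// mulrC.
Unshelve. all: by end_near. Qed.

Lemma good_turing_ratio : \forall n \near \oo, forall w, G n w / M n w =
  (occ_count U n 1 w / EK n 1) * (m1 n.-1 / m1 n) / (M n w / mean P (M n)).
Proof.
near=> n => w.
have n_gt0 : (0 < n)%N by near: n; exact: nbhs_infty_gt.
rewrite (mean_missing p01 hp hU) (mean_K1 p01 hp hU) /good_turing.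
have m1n := m1_gt0 n; have m1p := m1_gt0 n.-1.
have n0 : n%:R != 0 :> R by rewrite pnatr_eq0 -lt0n.
rewrite [in RHS]invf_div.
move: (occ_count _ _ _ _) (m1 n) (m1 n.-1) m1n m1p => x y z y0 z0.
(* The inverse is abstracted, so the identity also covers the points where the missing mass
   vanishes. *)
move: (missing_mass _ _ _ _)^-1 => u.
by field; rewrite n0 !gt_eqF.
Unshelve. all: by end_near. Qed.

Lemma good_turing_cvg_in_probability :
  cvg_in_probability P (fun n w => G n w / M n w) 1.
Proof.
apply: (cvg_in_probability_ratio count1_cvg_in_probability
  missing_cvg_in_probability mean_ratio_cvg).
- exact: measurable_K.
- exact: measurable_M.
- exact: measurable_GM.
- exact: good_turing_ratio.
Qed.

Section almost_surely.
Hypothesis bounded_ge2 : remains_bounded (fun n => EKge n 2 / EK n 1).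
Hypothesis EK_summable : forall c : R, 0 < c ->
  (\sum_(0 <= n <oo) (expR (- c * EK n 1))%:E < +oo)%E.

(** The exponent of [missing_deviation] is at sample size n + 1, hence the shift. *)
Lemma EK_summableS c : 0 < c ->
  (\sum_(0 <= n <oo) (expR (- c * EK n.+1 1))%:E < +oo)%E.
Proof.
move=> c0; apply: le_lt_trans (EK_summable c0).
rewrite [leRHS](nneseries_split 0 1)//= ?add0n.
rewrite -(@nneseries_addn _ (fun n => (expR (- c * EK n 1))%:E) 1); last first.
  by move=> k; rewrite lee_fin expR_ge0.
under [X in (_ <= _ + X)%E]eq_eseriesr do rewrite addn1.
by rewrite leeDr// big_nat1 lee_fin expR_ge0.
Qed.

Lemma missing_cvg_almost_surely :
  cvg_almost_surely P (fun n w => M n w / mean P (M n)) 1.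
Proof.
apply: (cvg_almost_surely_expR (a := fun n => EK n.+1 1)).
- exact: measurable_M.
- exact: EK_summableS.
- move=> eps e0; have [c c0 hc] := missing_deviation e0.
  by exists 2, c.
Qed.

(** EK_{>=1} = EK_1 + EK_{>=2}; this supplies the hypothesis of [count1_conc]. *)
Lemma mean_ge1_bound : exists2 C : R, 0 <= C &
  \forall n \near \oo, EKge n 1 <= C * EK n 1.
Proof.
have [C [n0 _ hC]] := bounded_ge2.
have C0 : 0 <= C by apply: le_trans (hC n0 (leqnn _)).
exists (1 + C); first by rewrite addr_ge0.
near=> n; have K0 : 0 < EK n 1 by apply: EK1_gt0; near: n; exact: nbhs_infty_gt.
have n0n : (n0 <= n)%N by near: n; exact: nbhs_infty_ge.
have := hC n n0n; rewrite /= normrM normfV (gtr0_norm K0) ler_pdivrMr// => h.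
have {}h := le_trans (ler_norm _) h.
suff : EKge n 1 = EK n 1 + EKge n 2 by lra.
rewrite !(mean_occ_count_ge p01 hp hU)// (mean_occ_count p01 hp hU)//.
have s g : g 0%N = false -> pos_summable (cell_mean p g n).
  move=> g0; have := @mean_summable _ p p01 hp (fun=> 1) g n.
  move=> /(_ _ g0) h'; suff -> : cell_mean p g n = (fun j => 1 * cell_mean p g n j).
    by apply: h' => j; rewrite ler01 lexx.
  by apply/funext => j; rewrite mul1r.
rewrite -tsumD; try exact: s.
apply: eq_tsum => j _.
rewrite /cell_mean -[X in _ = X + _]mul1r -[X in _ = _ + X]mul1r -bmean_lin.
by apply: eq_bmean => k; rewrite !mul1r -natrD; case: k => [|[|k]].
Unshelve. all: by end_near. Qed.

Lemma count1_cvg_almost_surely :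
  cvg_almost_surely P (fun n w => occ_count U n 1 w / EK n 1) 1.
Proof.
apply: (cvg_almost_surely_expR (a := fun n => EK n 1)) => //.
  exact: measurable_K.
move=> eps e0; have [C C0 hC] := mean_ge1_bound.
have [c c0 hc] := count1_conc p01 hp hU e0 C0.
exists 4, c; split=> //; near=> n.
have K0 : 0 < EK n 1 by apply: EK1_gt0; near: n; exact: nbhs_infty_gt.
by rewrite (deviation_set _ _ K0); apply: hc; near: n.
Unshelve. all: by end_near. Qed.

Lemma good_turing_cvg_almost_surely :
  cvg_almost_surely P (fun n w => G n w / M n w) 1.
Proof.
exact: (cvg_almost_surely_ratio count1_cvg_almost_surely missing_cvg_almost_surely
  mean_ratio_cvg good_turing_ratio).
Qed.
End almost_surely.
End consequences.

(** * The hypotheses on the means in the particular cases *)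

Section special_means.
Context d (T : measurableType d) (R : realType) (P : probability T R).
Context (p : nat -> R) (U : nat -> {RV P >-> nat}).
Hypothesis p01 : forall v, 0 <= p v <= 1.
Hypothesis hp : is_pmf p.
Hypothesis hU : iid_sample p U.

Local Notation EK n r := (mean P (occ_count U n r)).
Local Notation EKge n r := (mean P (occ_count_ge U n r)).

Lemma regular_blocks_EK t0 : regular_blocks p t0 -> nblock p t @[t --> +oo] --> +oo ->
  remains_bounded (fun n => EK n 2 / EK n 1) /\ EK n 1 @[n --> \oo] --> +oo.
Proof.
move=> rb Doo; have [[C hC] hD] := regular_blocks_mean p01 hp rb.
have [t0_gt0 _ _ b1] := rb.
split.
  exists C; near=> n.
  have n0 : t0 <= n%:R by near: n; exact: nbhs_infty_ger.
  have D1 := b1 _ n0.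
  have Dn : nblock p n%:R <= 16 * (n%:R * tmom p 1 n.-1) by near: n.
  rewrite (mean_K1 p01 hp hU) (mean_K2 p01 hp hU).
  have a0 : 0 < n%:R * tmom p 1 n.-1 by lra.
  rewrite ger0_norm; last by rewrite divr_ge0 ?(ltW a0)// mulr_ge0 ?tmom_ge0.
  by rewrite ler_pdivrMr//; near: n.
apply/cvgryPge => B.
have [s0 s0_gt0 hs] : exists2 s0 : R, 0 < s0 & forall t, s0 <= t -> 16 * B <= nblock p t.
  by apply: near_pinfty_ge; move/cvgryPge: Doo; exact.
near=> n.
have n0 : s0 <= n%:R by near: n; exact: nbhs_infty_ger.
have Dn : nblock p n%:R <= 16 * (n%:R * tmom p 1 n.-1) by near: n.
by rewrite (mean_K1 p01 hp hU); have := hs _ n0; lra.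
Unshelve. all: by end_near. Qed.

(** EK_{>=2} is at most light + N, both O(D(n)), hence O(EK_1). Conversely EK_1 >= D(n) / 16 >= (c1
    / 16) N(n), and a power of N dominates n, so [expR_summable] applies. *)
Lemma regularly_varying_EK alpha : 0 < alpha <= 1 ->
  regularly_varying (counting_fun p) alpha ->
  remains_bounded (fun n => EKge n 2 / EK n 1) /\
  forall c : R, 0 < c -> (\sum_(0 <= n <oo) (expR (- c * EK n 1))%:E < +oo)%E.
Proof.
move=> a01 rv.
have [t0 rb [Doo [c1 c10 hc1] [m [c2 c20 hc2]]]] := regularly_varying_blocks p01 hp a01 rv.
have [_ hD] := regular_blocks_mean p01 hp rb.
have [t0_gt0 bD bH b1] := rb.
split.
  exists (16 * (4 + c1^-1)); near=> n.
  have n_gt0 : (0 < n)%N by near: n; exact: nbhs_infty_gt.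
  have n0 : t0 <= n%:R by near: n; exact: nbhs_infty_ger.
  have D1 := b1 _ n0.
  have Dn : nblock p n%:R <= 16 * (n%:R * tmom p 1 n.-1) by near: n.
  rewrite (mean_K1 p01 hp hU) (mean_occ_count_ge p01 hp hU)//.
  have a0 : 0 < n%:R * tmom p 1 n.-1 by lra.
  rewrite ger0_norm; last first.
    by rewrite divr_ge0 ?(ltW a0)// tsum_ge0// => j _; exact: cell_mean_ge0.
  rewrite ler_pdivrMr//; apply: le_trans (mean_ge2_le p01 hp n_gt0) _.
  have := light_block p01 hp t0_gt0 bD b1 n0.
  have : ncount p n%:R <= c1^-1 * nblock p n%:R by rewrite ler_pdivlMl// hc1.
  have c1V : 0 < c1^-1 by rewrite invr_gt0.
  have := ler_wpM2l (ltW c1V) Dn.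
  lra.
have [n1 _ hn1] : \forall n \near \oo, t0 <= n%:R /\ nblock p n%:R <= 16 * (n%:R * tmom p 1 n.-1).
  by near=> n; split; near: n; [exact: nbhs_infty_ger|].
apply: (@expR_summable _ (fun n => EK n 1) m ((c1 / 16) ^+ m.+1 * c2) n1).
- by rewrite mulr_gt0// exprn_gt0// divr_gt0.
- by move=> n; rewrite (mean_K1 p01 hp hU) mulr_ge0// tmom_ge0.
move=> n /hn1 /= [n0 Dn]; rewrite (mean_K1 p01 hp hU).
rewrite -mulrA; apply: (@le_trans _ _ ((c1 / 16 * ncount p n%:R) ^+ m.+1)).
  by rewrite [leRHS]exprMn ler_wpM2l ?hc2// exprn_ge0// divr_ge0// ltW.
have N0 : 0 <= ncount p n%:R by apply: tsum_ge0.
have cD := hc1 _ n0.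
apply: lerXn2r; rewrite ?nnegrE.
- by rewrite mulr_ge0// divr_ge0// ltW.
- by rewrite mulr_ge0// tmom_ge0.
- lra.
Unshelve. all: by end_near. Qed.
End special_means.

Unset Implicit Arguments.

Theorem corollary5p3 (d : measure_display) (T : measurableType d)
    (R : realType) (P : probability T R) (p : nat -> R)
    (U : nat -> {RV P >-> nat})
    (hp : is_pmf p) (hU : iid_sample p U) :
  let EK n r := mean P (occ_count U n r) in
  let EKge n r := mean P (occ_count_ge U n r) in
  let M := missing_mass p U in
  let G := good_turing U in
  let nu := counting_fun p in
  let hyp_i :=
    remains_bounded (fun n => EK n 2%N / EK n 1%N) /\
    EK n 1%N @[n --> \oo] --> +oo in
  let hyp_ii :=
    remains_bounded (fun n => EKge n 2%N / EK n 1%N) /\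
    (forall c : R, 0 < c ->
       (\sum_(0 <= n <oo) (expR (- c * EK n 1%N))%:E < +oo)%E) in
  [/\ (* (i) *)
      hyp_i ->
        cvg_in_probability P (fun n w => M n w / mean P (M n)) 1 /\
        cvg_in_probability P (fun n w => G n w / M n w) 1,
      (* particular cases of (i) *)
      ((exists2 alpha : R, 0 < alpha <= 1 & regularly_varying nu alpha) \/
       (regularly_varying nu 0 /\
        exists2 a : R -> R, de_Haan_class a (fun x => nu (1 / x)) &
          a x @[x --> +oo] --> +oo)) -> hyp_i,
      (* (ii) *)
      hyp_i -> hyp_ii ->
        cvg_almost_surely P (fun n w => M n w / mean P (M n)) 1 /\
        cvg_almost_surely P (fun n w => G n w / M n w) 1 &
      (* particular case of (ii) *)
      (exists2 alpha : R, 0 < alpha <= 1 & regularly_varying nu alpha) ->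
        hyp_ii].
Proof.
(* [is_pmf] leaves [p 0] free. Setting it to 0 changes none of the quantities involved and gives 0
   <= p' v <= 1 at every index, as the preceding sections assume. *)
pose p' j := if j == 0%N then 0 else p j.
have p'E j : (1 <= j)%N -> p' j = p j by case: j.
have hp' : is_pmf p'.
  have [p_ge0 p_sum] := hp; split=> [j j1|]; first by rewrite p'E// p_ge0.
  by rewrite -p_sum; exact: eq_eseries1.
have hU' : iid_sample p' U.
  by have [ind law] := hU; split=> // i j j1; rewrite p'E// law.
have p'0 v : 0 <= p' v.
  by case: v => [|v]; [rewrite /p'|rewrite p'E//; case: hp => + _; exact].
have p'01 v : 0 <= p' v <= 1.
  rewrite p'0/=; case: v => [|v]; first by rewrite /p'.
  have s : pos_summable p' by split=> // ; case: hp' => _ ->; exact: ltry.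
  have := tsum_partial v.+2 s; rewrite big_nat_recr//= (pmf_tsum hp').
  by apply: le_trans; rewrite lerDr sumr_ge0.
have ME : missing_mass p U = missing_mass p' U.
  apply/funext => n; apply/funext => w; congr fine.
  by apply: (@eq_eseries1 _ (fun j => p j * _) (fun j => p' j * _)) => j j1; rewrite p'E.
have nuE : counting_fun p = counting_fun p'.
  apply/funext => x; rewrite /counting_fun.
  rewrite (_ : [set j | _] = [set j : nat | (1 <= j)%N /\ x <= p' j])//.
  by apply/seteqP; split=> j /= [j1]; rewrite p'E.
rewrite /= ME nuE; split.
- move=> [b2 EKoo]; split.
    exact: (missing_cvg_in_probability p'01 hp' hU').
  exact: (good_turing_cvg_in_probability p'01 hp' hU').
- case=> [[alpha a01 rv]|[_ [a ha aoo]]].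
    have [t0 rb [Doo _ _]] := regularly_varying_blocks p'01 hp' a01 rv.
    exact: (regular_blocks_EK p'01 hp' hU' rb Doo).
  have [t0 rb Doo] := de_Haan_blocks p'01 hp' ha aoo.
  exact: (regular_blocks_EK p'01 hp' hU' rb Doo).
- move=> [b2 EKoo] [bge2 sE]; split.
    exact: (missing_cvg_almost_surely p'01 hp' hU').
  exact: (good_turing_cvg_almost_surely p'01 hp' hU').
- by move=> [alpha a01 rv]; exact: (regularly_varying_EK p'01 hp' hU' a01 rv).
Qed.
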